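(* Let $\gamma_1,\delta_1,\delta_2,\delta_3,x,y,\rho_1,\rho_2\in\mathbb{C}$ with $\operatorname{Re}\rho_1>0$, $\operatorname{Re}\rho_2>0$, let $\alpha_1,\alpha_2,\alpha_3,\beta_1,\beta_2,\beta_3,\mu_1,\mu_2$ be positive real numbers, and let $\operatorname{Re}p>0$, $\operatorname{Re}q>0$. Then $$L_2\left\{t_1^{\rho_1-1}t_2^{\rho_2-1}E_8\left(\begin{matrix}\gamma_1,\alpha_1,\beta_1;\\ \delta_1,\alpha_2,\beta_2;\delta_2,\alpha_3;\delta_3,\beta_3;\end{matrix}\left|\begin{matrix}xt_1^{\mu_1}\\ yt_2^{\mu_2}\end{matrix}\right.\right);p,q\right\}=\frac{\Gamma(\rho_1)\Gamma(\rho_2)}{p^{\rho_1}q^{\rho_2}}D_1\left(\begin{matrix}\gamma_1,\alpha_1,\beta_1;\rho_1,\mu_1;\rho_2,\mu_2;\\ \delta_1,\alpha_2,\beta_2;\delta_2,\alpha_3;\delta_3,\beta_3;\end{matrix}\left|\begin{matrix}x/p^{\mu_1}\\ y/q^{\mu_2}\end{matrix}\right.\right).$$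
   Context: $L_2\{f(t_1,t_2);p,q\}=\int_0^\infty\int_0^\infty f(t_1,t_2)e^{-t_1p-t_2q}\,dt_1\,dt_2$ is the two-dimensional Laplace transform. $(\gamma)_\lambda=\Gamma(\gamma+\lambda)/\Gamma(\gamma)$ for $\gamma\in\mathbb{C}$ and real $\lambda\ge0$. For complex $\gamma_i,\delta_i,x,y$ and positive real $\alpha_i,\beta_i$, $$D_1\left(\begin{matrix}\gamma_1,\alpha_1,\beta_1;\gamma_2,\alpha_2;\gamma_3,\beta_2;\\ \delta_1,\alpha_3,\beta_3;\delta_2,\alpha_4;\delta_3,\beta_4;\end{matrix}\left|\begin{matrix}x\\ y\end{matrix}\right.\right)=\sum_{m,n=0}^{\infty}\frac{(\gamma_1)_{\alpha_1 m+\beta_1 n}(\gamma_2)_{\alpha_2 m}(\gamma_3)_{\beta_2 n}}{\Gamma(\delta_1+\alpha_3 m+\beta_3 n)}\frac{x^m}{\Gamma(\delta_2+\alpha_4 m)}\frac{y^n}{\Gamma(\delta_3+\beta_4 n)},$$ $$E_8\left(\begin{matrix}\gamma_1,\alpha_1,\beta_1;\\ \delta_1,\alpha_2,\beta_2;\delta_2,\alpha_3;\delta_3,\beta_3;\end{matrix}\left|\begin{matrix}x\\ y\end{matrix}\right.\right)=\sum_{m,n=0}^{\infty}\frac{(\gamma_1)_{\alpha_1 m+\beta_1 n}}{\Gamma(\delta_1+\alpha_2 m+\beta_2 n)}\frac{x^m}{\Gamma(\delta_2+\alpha_3 m)}\frac{y^n}{\Gamma(\delta_3+\beta_3 n)}.$$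 The functions are considered at arguments in the region of absolute convergence of their defining series; powers of $p,q$ are principal.
   Formalization: The transform can diverge for complex p, q although D_1 converges, so the identity is proved whenever the double Laplace integral converges absolutely; that convergence is proved when D_1 converges absolutely at x/(Re p)^{mu_1}, y/(Re q)^{mu_2}. *)

(* Defs.v *)
From mathcomp Require Import all_boot all_order all_algebra.
From mathcomp Require Import all_classical all_reals all_analysis.
From mathcomp Require Import complex.

Set Implicit Arguments.
Unset Strict Implicit.
Unset Printing Implicit Defensive.

Import Order.TTheory GRing.Theory Num.Theory.
Import numFieldNormedType.Exports.

Local Open Scope classical_set_scope.
Local Open Scope ring_scope.
Local Open Scope complex_scope.

(* the R-valued parts, not Num.Re and Num.Im *)
Local Notation Re := complex.Re.
Local Notation Im := complex.Im.
Local Notation normc := ComplexField.Normc.normc.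

Section ComplexFunctions.
Context {R : realType}.
Implicit Types z w : R[i].

Definition cexp z : R[i] :=
  (expR (Re z) * cos (Im z)) +i* (expR (Re z) * sin (Im z)).

(* Principal argument, in ]-pi, pi], for z != 0. *)
Definition carg z : R :=
  if 0 <= Im z then acos (Re z / normc z)
  else - acos (Re z / normc z).

Definition clog z : R[i] := ln (normc z) +i* carg z.

(* Principal power; only meaningful for a nonzero base z. *)
Definition cpow z w : R[i] := cexp (w * clog z).

Section ComplexIntegral.
Context {d : measure_display} {T : measurableType d}.
Variable mu : {measure set T -> \bar R}.

(* Both parts integrable, i.e. f measurable on D and |f| integrable on D. *)
Definition cintegrable (D : set T) (f : T -> R[i]) : Prop :=
  mu.-integrable D (EFin \o (fun t => Re (f t))) /\
  mu.-integrable D (EFin \o (fun t => Im (f t))).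

Definition cintegral (D : set T) (f : T -> R[i]) : R[i] :=
  Rintegral mu D (fun t => Re (f t)) +i* Rintegral mu D (fun t => Im (f t)).

End ComplexIntegral.

Definition euler_integral z : R[i] :=
  cintegral lebesgue_measure `]0, +oo[
    (fun t : R => cpow t%:C (z - 1) * cexp (- t%:C)).

(* Gamma is Euler's integral for Re z > 0, continued to Re z <= 0 by
   Gamma (z + 1) = z * Gamma z, using the shift N = floor (- Re z) + 1 (the
   least one with Re (z + N) > 0).  At the poles 0, -1, -2, ... one factor of
   the product vanishes and, as 0^-1 = 0, both Gamma z and (Gamma z)^-1 are 0;
   so (Gamma z)^-1 is everywhere the entire function 1 / Gamma. *)
Definition Gamma_shift z : nat :=
  if 0 < Re z then 0%N else (Num.truncn (- Re z)).+1.

Definition Gamma z : R[i] :=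
  euler_integral (z + (Gamma_shift z)%:R) /
  \prod_(k < Gamma_shift z) (z + k%:R).

(* (g)_l = Gamma (g + l) / Gamma g.  For g = 0, -1, -2, ... and l a natural
   number this quotient is read as its limit g (g + 1) ... (g + l - 1); for such
   g and other l it is 0, the value of the quotient being Gamma (g + l) * 0. *)
Definition poch (g : R[i]) (l : R) : R[i] :=
  if [&& Im g == 0, - Re g \is a Num.nat & l \is a Num.nat]
  then \prod_(k < Num.truncn l) (g + k%:R)
  else Gamma (g + l%:C) / Gamma g.

Definition cseries (u : nat -> R[i]) : R[i] :=
  limn (series (fun n => Re (u n))) +i* limn (series (fun n => Im (u n))).

(* Iterated sum, used together with abs_cvg2 below. *)
Definition cseries2 (c : nat -> nat -> R[i]) : R[i] :=
  cseries (fun m => cseries (c m)).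

Definition abs_cvg2 (c : nat -> nat -> R[i]) : Prop :=
  summable [set: nat * nat] (fun k => (normc (c k.1 k.2))%:E).

Definition D1_term
    (g1 : R[i]) (a1 b1 : R) (g2 : R[i]) (a2 : R) (g3 : R[i]) (b2 : R)
    (d1 : R[i]) (a3 b3 : R) (d2 : R[i]) (a4 : R) (d3 : R[i]) (b4 : R)
    (x y : R[i]) (m n : nat) : R[i] :=
  (poch g1 (a1 * m%:R + b1 * n%:R) * poch g2 (a2 * m%:R) *
     poch g3 (b2 * n%:R)) / Gamma (d1 + (a3 * m%:R + b3 * n%:R)%:C) *
  (x ^+ m / Gamma (d2 + (a4 * m%:R)%:C)) *
  (y ^+ n / Gamma (d3 + (b4 * n%:R)%:C)).

Definition D1 g1 a1 b1 g2 a2 g3 b2 d1 a3 b3 d2 a4 d3 b4 x y : R[i] :=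
  cseries2 (D1_term g1 a1 b1 g2 a2 g3 b2 d1 a3 b3 d2 a4 d3 b4 x y).

Definition D1_abs_cvg g1 a1 b1 g2 a2 g3 b2 d1 a3 b3 d2 a4 d3 b4 x y : Prop :=
  abs_cvg2 (D1_term g1 a1 b1 g2 a2 g3 b2 d1 a3 b3 d2 a4 d3 b4 x y).

Definition E8_term
    (g1 : R[i]) (a1 b1 : R)
    (d1 : R[i]) (a2 b2 : R) (d2 : R[i]) (a3 : R) (d3 : R[i]) (b3 : R)
    (x y : R[i]) (m n : nat) : R[i] :=
  poch g1 (a1 * m%:R + b1 * n%:R) / Gamma (d1 + (a2 * m%:R + b2 * n%:R)%:C) *
  (x ^+ m / Gamma (d2 + (a3 * m%:R)%:C)) *
  (y ^+ n / Gamma (d3 + (b3 * n%:R)%:C)).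

Definition E8 g1 a1 b1 d1 a2 b2 d2 a3 d3 b3 x y : R[i] :=
  cseries2 (E8_term g1 a1 b1 d1 a2 b2 d2 a3 d3 b3 x y).

Definition E8_abs_cvg g1 a1 b1 d1 a2 b2 d2 a3 d3 b3 x y : Prop :=
  abs_cvg2 (E8_term g1 a1 b1 d1 a2 b2 d2 a3 d3 b3 x y).

Definition quadrant : set (R * R) := `]0, +oo[ `*` `]0, +oo[.

Definition laplace2_integrand (f : R -> R -> R[i]) (p q : R[i]) (t : R * R) :
    R[i] :=
  f t.1 t.2 * cexp (- (t.1%:C * p) - t.2%:C * q).

Definition laplace2 (f : R -> R -> R[i]) (p q : R[i]) : R[i] :=
  cintegral (lebesgue_measure \x lebesgue_measure)%E quadrant
    (laplace2_integrand f p q).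

(* The Laplace integral converges absolutely. *)
Definition laplace2_exists (f : R -> R -> R[i]) (p q : R[i]) : Prop :=
  cintegrable (lebesgue_measure \x lebesgue_measure)%E quadrant
    (laplace2_integrand f p q).

End ComplexFunctions.

(* Main.v *)
Require Import Defs.
From mathcomp Require Import all_boot all_order all_algebra.
From mathcomp Require Import all_classical all_reals all_analysis.
From mathcomp Require Import measurable_realfun complex ring lra.

Set Implicit Arguments.
Unset Strict Implicit.
Unset Printing Implicit Defensive.

Import Order.TTheory GRing.Theory Num.Theory.
Import numFieldNormedType.Exports ComplexField.Normc.
Local Open Scope classical_set_scope.
Local Open Scope ring_scope.
Local Open Scope complex_scope.

Local Notation Re := complex.Re.
Local Notation Im := complex.Im.

(** Expanding E8 and integrating term by term gives the formula, since the
Laplace transform of [t ^ (rho + mu m - 1)] at [p] is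
[Gamma (rho + mu m) / p ^ (rho + mu m)], and [Gamma (rho + mu m)] is
[Gamma rho] times the Pochhammer symbol of D1.  Three points need an argument.

The transform of a power at a complex [p] ([laplace_powE]).  On the positive
reals it is a dilation.  The function
[exp (w d) * int t ^ (w - 1) exp (- t P exp d) dt] of the complex variable [d]
is constant for real [d], so its derivative at [0] vanishes; its increments
along the segment from [0] to [log p] are therefore quadratically small and it
is constant there.  The same vanishing derivative is the functional equation of
Gamma.

Tonelli's theorem ([laplace2_E8]).  The integral of the modulus of a term
involves [Gamma (Re rho + mu m)], while the modulus of the D1 term involves
[|Gamma (rho + mu m)|] and [|p|] is replaced by [Re p].  The quotient of the two
Gamma values stays bounded ([rgamma_le_Gamma]), so absolute convergence of D1 at
[x / (Re p) ^ mu1, y / (Re q) ^ mu2] is exactly what is needed.  This settles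
the existence of the Laplace integral.

The formula under the sole assumption that the Laplace integral exists and that
D1 converges absolutely at [x / p ^ mu1, y / q ^ mu2].  Tonelli's theorem may
fail at [(p, q)], but it applies at [(s p, s q)] for large real [s], because
[s Re p >= |p|] there.  With [x1 = x / p ^ mu1] and [y1 = y / q ^ mu2], the series
at [(s p, s q)] for the data [x, y] is, up to a constant, the series at [(s, s)]
for the data [x1, y1], and for the latter Tonelli's theorem applies for every
[s >= 1].  Hence [p ^ rho1 * q ^ rho2] times the transform at [(s p, s q)] for
[x, y] equals the transform at [(s, s)] for [x1, y1] when [s] is large.  Both
sides are Laplace integrals in [s] whose phases lie in a sector around the
positive reals, and [laplace_continuation] brings the equality down to [s = 1]. *)

(** * Complex numbers and the complex exponential *)

Section ComplexNumbers.
Context {R : realType}.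
Implicit Types (z w : R[i]) (x y : R).

Lemma eqcP z w : Re z = Re w -> Im z = Im w -> z = w.
Proof. by case: z => a b; case: w => c d /= -> ->. Qed.

Lemma cReD z w : Re (z + w) = Re z + Re w. Proof. by case: z; case: w. Qed.
Lemma cImD z w : Im (z + w) = Im z + Im w. Proof. by case: z; case: w. Qed.
Lemma cReN z : Re (- z) = - Re z. Proof. by case: z. Qed.
Lemma cImN z : Im (- z) = - Im z. Proof. by case: z. Qed.
Lemma cReB z w : Re (z - w) = Re z - Re w. Proof. by rewrite cReD cReN. Qed.
Lemma cImB z w : Im (z - w) = Im z - Im w. Proof. by rewrite cImD cImN. Qed.
Lemma cReM z w : Re (z * w) = Re z * Re w - Im z * Im w.
Proof. by case: z; case: w. Qed.
Lemma cImM z w : Im (z * w) = Re z * Im w + Im z * Re w.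
Proof. by case: z; case: w. Qed.
Lemma cReRM x z : Re (x%:C * z) = x * Re z.
Proof. by rewrite cReM /= mul0r subr0. Qed.
Lemma cImRM x z : Im (x%:C * z) = x * Im z.
Proof. by rewrite cImM /= mul0r addr0. Qed.

Definition cReImE := (cReD, cImD, cReB, cImB, cReN, cImN, cReRM, cImRM, cReM, cImM).

Lemma cRe_sum n (u : nat -> R[i]) : Re (\sum_(k < n) u k) = \sum_(k < n) Re (u k).
Proof. by elim: n => [|n IH]; rewrite ?big_ord0// !big_ord_recr/= cReD IH. Qed.
Lemma cIm_sum n (u : nat -> R[i]) : Im (\sum_(k < n) u k) = \sum_(k < n) Im (u k).
Proof. by elim: n => [|n IH]; rewrite ?big_ord0// !big_ord_recr/= cImD IH. Qed.

Lemma normc_ReIm z : normc z = Num.sqrt (Re z ^+ 2 + Im z ^+ 2).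
Proof. by case: z. Qed.
Lemma normc_ge0 z : 0 <= normc z. Proof. by rewrite normc_ReIm sqrtr_ge0. Qed.
Lemma sqr_normc2 z : normc z ^+ 2 = Re z ^+ 2 + Im z ^+ 2.
Proof. by rewrite normc_ReIm sqr_sqrtr// addr_ge0// sqr_ge0. Qed.
Lemma normcX z n : normc (z ^+ n) = normc z ^+ n.
Proof. by elim: n => [|n IH]; rewrite ?normc1// !exprS normcM IH. Qed.
Lemma normc_real x : normc x%:C = `|x|.
Proof. by rewrite normc_ReIm/= expr0n addr0 sqrtr_sqr. Qed.
Lemma normc_gt0 z : (0 < normc z) = (z != 0).
Proof.
rewrite lt_def normc_ge0 andbT; congr (~~ _).
by apply/eqP/eqP => [/eq0_normc//|->]; rewrite normc0.
Qed.
Lemma ler_normcD z w : normc (z + w) <= normc z + normc w.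
Proof. exact: le_normcD. Qed.
Lemma normcN z : normc (- z) = normc z.
Proof. exact: complex.normcN. Qed.
Lemma ler_normcB z w : normc (z - w) <= normc z + normc w.
Proof. by rewrite -(normcN w) ler_normcD. Qed.
Lemma normcB z w : normc (z - w) = normc (w - z).
Proof. by rewrite -normcN opprB. Qed.

Lemma Re_le_normc z : `|Re z| <= normc z.
Proof.
rewrite -(@ler_pXn2r _ 2)// ?nnegrE ?normc_ge0//.
by rewrite sqr_normc2 real_normK ?num_real// lerDl sqr_ge0.
Qed.
Lemma Im_le_normc z : `|Im z| <= normc z.
Proof.
rewrite -(@ler_pXn2r _ 2)// ?nnegrE ?normc_ge0//.
by rewrite sqr_normc2 real_normK ?num_real// lerDr sqr_ge0.
Qed.
Lemma normc_le_ReIm z : normc z <= `|Re z| + `|Im z|.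
Proof.
rewrite -(@ler_pXn2r _ 2)// ?nnegrE ?normc_ge0 ?addr_ge0//.
rewrite sqr_normc2 sqrrD !real_normK ?num_real//.
by have := mulr_ge0 (normr_ge0 (Re z)) (normr_ge0 (Im z)); lra.
Qed.

Lemma normcXB z w n B : normc z <= B -> normc w <= B ->
  normc (z ^+ n - w ^+ n) <= n%:R * normc (z - w) * B ^+ n.-1.
Proof.
move=> zB wB; have B0 : 0 <= B := le_trans (normc_ge0 z) zB.
elim: n => [|n IH]; first by rewrite !expr0 subrr normc0 !mul0r.
have -> : z ^+ n.+1 - w ^+ n.+1 = z * (z ^+ n - w ^+ n) + (z - w) * w ^+ n.
  by rewrite !exprS; ring.
apply: (le_trans (ler_normcD _ _)); rewrite !normcM normcX /=.
have h1 : normc z * normc (z ^+ n - w ^+ n) <= n%:R * normc (z - w) * B ^+ n.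
  apply: (le_trans (ler_pM (normc_ge0 _) (normc_ge0 _) zB IH)).
  case: n {IH} => [|n] /=; first by rewrite !mul0r mulr0.
  by rewrite exprS; lra.
have h2 : normc (z - w) * normc w ^+ n <= normc (z - w) * B ^+ n.
  by rewrite ler_wpM2l ?normc_ge0// lerXn2r ?nnegrE ?normc_ge0.
by rewrite -natr1 !mulrDl mul1r lerD.
Qed.

Lemma Re_cexp z : Re (cexp z) = expR (Re z) * cos (Im z). Proof. by []. Qed.
Lemma Im_cexp z : Im (cexp z) = expR (Re z) * sin (Im z). Proof. by []. Qed.

Lemma cexpD z w : cexp (z + w) = cexp z * cexp w.
Proof.
by apply: eqcP; rewrite cReImE !(Re_cexp, Im_cexp) !cReImE expRD ?cosD ?sinD; ring.
Qed.

Lemma cexp0 : cexp (0 : R[i]) = 1.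
Proof. by apply: eqcP; rewrite /= expR0 ?cos0 ?sin0 ?mulr1 ?mulr0. Qed.

Lemma normc_cexp z : normc (cexp z) = expR (Re z).
Proof.
rewrite normc_ReIm Re_cexp Im_cexp !exprMn -mulrDr cos2Dsin2 mulr1 sqrtr_sqr.
by rewrite ger0_norm// expR_ge0.
Qed.

Lemma cexp_neq0 z : cexp z != 0.
Proof. by rewrite -normc_gt0 normc_cexp expR_gt0. Qed.

Lemma cexpN z : cexp (- z) = (cexp z)^-1.
Proof.
apply: (mulIf (cexp_neq0 z)); rewrite -cexpD addNr cexp0 mulVf//.
exact: cexp_neq0.
Qed.

Lemma cexp_real x : cexp x%:C = (expR x)%:C.
Proof. by apply: eqcP; rewrite /= ?cos0 ?sin0 ?mulr1 ?mulr0. Qed.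

Lemma cexpMn z n : cexp (n%:R * z) = cexp z ^+ n.
Proof.
elim: n => [|n IH]; first by rewrite mul0r cexp0.
by rewrite -natr1 mulrDl mul1r cexpD IH exprSr.
Qed.

Lemma normr_sin_le y : `|sin y| <= `|y|.
Proof.
wlog y0 : y / 0 <= y.
  move=> H; have [/H//|/ltW y0] := leP 0 y.
  by rewrite -normrN -sinN -[in leRHS]normrN H ?oppr_ge0.
have [c _] := @MVT_segment R sin cos 0 y y0 (fun x _ => is_derive_sin x)
  (continuous_subspaceT (@continuous_sin R)).
by rewrite sin0 !subr0 => ->; rewrite normrM ler_piMl// cos_max.
Qed.

Lemma cos_ge1Bsqr y : 1 - y ^+ 2 / 2 <= cos y.
Proof.
have -> : cos y = 1 - 2 * sin (y / 2) ^+ 2.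
  have -> : cos y = cos ((y / 2) *+ 2) by congr cos; lra.
  by rewrite cos_mulr2n cos2sin2; lra.
have : sin (y / 2) ^+ 2 <= (y / 2) ^+ 2.
  by rewrite -real_normK ?num_real// -[leRHS]real_normK ?num_real// lerXn2r ?nnegrE// normr_sin_le.
by rewrite expr_div_n; lra.
Qed.

Lemma normr_1Bcos_le y : `|1 - cos y| <= `|y|.
Proof.
rewrite ger0_norm ?subr_ge0 ?cos_le1//.
have [y2|y2] := leP 2 `|y|; first by have := cos_geN1 y; lra.
have := cos_ge1Bsqr y; rewrite -[y ^+ 2]real_normK ?num_real// => h.
have : 0 <= `|y| * (2 - `|y|) by rewrite mulr_ge0// subr_ge0 ltW.
by lra.
Qed.

Lemma normr_sinB_le y : `|sin y - y| <= y ^+ 2.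
Proof.
wlog y0 : y / 0 <= y.
  move=> H; have [/H//|/ltW y0] := leP 0 y.
  have -> : sin y - y = - (sin (- y) - - y) by rewrite sinN; ring.
  by rewrite normrN -[y ^+ 2]sqrrN H// oppr_ge0.
have dF (x : R) : x \in `]0, y[ -> is_derive x 1 (fun t : R => sin t - t) (cos x - 1).
  by move=> _; apply: is_deriveB.
have cF : {within `[0, y], continuous (fun t : R => sin t - t)}.
  apply: continuous_subspaceT => x; apply: cvgB; last exact: cvg_id.
  exact: continuous_sin.
have [c c0y] := MVT_segment y0 dF cF.
rewrite sin0 !subr0 => ->.
rewrite normrM distrC (ger0_norm y0) expr2 ler_wpM2r//.
move: c0y; rewrite in_itv/= => /andP[c0 cy].
by apply: (le_trans (normr_1Bcos_le _)); rewrite ger0_norm.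
Qed.

Lemma expR1B_le x : `|expR x - 1| <= `|x| * expR `|x|.
Proof.
have h1 := expR_ge1Dx x; have h2 := expR_ge1Dx (- x).
have e0 := expR_gt0 x.
have h3 : expR x - 1 <= x * expR x.
  have : expR x * (1 - x) <= expR x * expR (- x) by rewrite ler_wpM2l// ltW.
  by rewrite -expRD subrr expR0; lra.
have [x0|x0] := leP 0 x.
  by rewrite !ger0_norm//; lra.
rewrite (ltr0_norm x0) ltr0_norm; last by rewrite subr_lt0 expR_lt1.
have : 0 <= - x * (expR (- x) - 1).
  by rewrite mulr_ge0 ?oppr_ge0 ?(ltW x0)// subr_ge0 -expR0 ler_expR oppr_ge0 ltW.
by lra.
Qed.

Lemma expR1DB_le x : `|expR x - 1 - x| <= `|x| ^+ 2 * expR `|x|.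
Proof.
have h1 := expR_ge1Dx x.
have h2 : expR x - 1 - x <= x * (expR x - 1).
  have := expR_ge1Dx (- x) => h2.
  have : expR x * (1 - x) <= expR x * expR (- x) by rewrite ler_wpM2l// expR_ge0.
  by rewrite -expRD subrr expR0; lra.
rewrite ger0_norm; last by lra.
apply: (le_trans h2); apply: (le_trans (ler_norm _)).
by rewrite normrM expr2 -mulrA ler_wpM2l// expR1B_le.
Qed.

Lemma normc_cexp1B_le z : normc (cexp z - 1) <= 3 * normc z * expR (normc z).
Proof.
set x := Re z; set y := Im z.
have xz : `|x| <= normc z := Re_le_normc z.
have yz : `|y| <= normc z := Im_le_normc z.
have z0 := normc_ge0 z.
have ex : expR x <= expR (normc z) by rewrite ler_expR (le_trans (ler_norm _)).
have exn : expR `|x| <= expR (normc z) by rewrite ler_expR.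
have -> : cexp z - 1 = (expR x - 1)%:C + (expR x)%:C * ((cos y - 1) +i* sin y).
  by apply: eqcP; rewrite !cReImE ?(Re_cexp, Im_cexp) /=; ring.
apply: (le_trans (ler_normcD _ _)).
rewrite normcM !normc_real [`|expR x|]ger0_norm ?expR_ge0//.
have h1 : `|expR x - 1| <= normc z * expR (normc z).
  by apply: (le_trans (expR1B_le x)); rewrite ler_pM// expR_ge0.
have h2 : normc ((cos y - 1) +i* sin y) <= 2 * normc z.
  apply: (le_trans (normc_le_ReIm _)) => /=.
  by have := normr_1Bcos_le y; rewrite distrC; have := normr_sin_le y; lra.
have h3 : expR x * normc ((cos y - 1) +i* sin y) <= expR (normc z) * (2 * normc z).
  by rewrite ler_pM// ?expR_ge0 ?normc_ge0.
by lra.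
Qed.

Lemma normc_cexp1DB_le z :
  normc (cexp z - 1 - z) <= 4 * normc z ^+ 2 * expR (normc z).
Proof.
set x := Re z; set y := Im z; set r := normc z.
have xz : `|x| <= r := Re_le_normc z.
have yz : `|y| <= r := Im_le_normc z.
have r0 : 0 <= r := normc_ge0 z.
have e1 : 1 <= expR r by rewrite -expR0 ler_expR.
have ex : expR x <= expR r by rewrite ler_expR (le_trans (ler_norm _)).
have exn : expR `|x| <= expR r by rewrite ler_expR.
have y2 : y ^+ 2 <= r ^+ 2 by rewrite -real_normK ?num_real// lerXn2r ?nnegrE.
have -> : cexp z - 1 - z = (expR x - 1 - x)%:C +
   ((expR x)%:C * ((cos y - 1) +i* (sin y - y)) + (expR x - 1)%:C * (0 +i* y)).
  by apply: eqcP; rewrite !cReImE ?(Re_cexp, Im_cexp) /= -/x -/y; ring.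
apply: (le_trans (ler_normcD _ _)).
have h1 : `|expR x - 1 - x| <= r ^+ 2 * expR r.
  by apply: (le_trans (expR1DB_le x)); rewrite ler_pM ?expR_ge0// lerXn2r ?nnegrE.
have h2 : normc ((cos y - 1) +i* (sin y - y)) <= 2 * r ^+ 2.
  apply: (le_trans (normc_le_ReIm _)) => /=.
  have := normr_sinB_le y; have := cos_ge1Bsqr y; have := cos_le1 y.
  rewrite -subr_le0 => c0; rewrite (ler0_norm c0).
  by have := sqr_ge0 y; lra.
have h3 : expR x * normc ((cos y - 1) +i* (sin y - y)) <= expR r * (2 * r ^+ 2).
  by rewrite ler_pM// ?expR_ge0 ?normc_ge0.
have h4 : `|expR x - 1| * normc (0 +i* y) <= r * expR r * r.
  rewrite ler_pM ?normc_ge0//.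
    by apply: (le_trans (expR1B_le x)); rewrite ler_pM// expR_ge0.
  by apply: (le_trans (normc_le_ReIm _)); rewrite /= normr0 add0r.
have h5 := ler_normcD ((expR x)%:C * ((cos y - 1) +i* (sin y - y)))
   ((expR x - 1)%:C * (0 +i* y)).
rewrite !normcM !normc_real [`|expR x|]ger0_norm ?expR_ge0// in h5.
by rewrite normc_real; lra.
Qed.

(** On this half-plane no exponential factor is lost, which makes the bound
usable for all phases at once. *)
Lemma normc_1Bcexp_le z : 0 <= Re z -> normc (1 - cexp (- z)) <= 3 * normc z.
Proof.
set x := Re z; set y := Im z => x0.
have xz : x <= normc z := le_trans (ler_norm _) (Re_le_normc z).
have yz : `|y| <= normc z := Im_le_normc z.
have z0 := normc_ge0 z.
have -> : 1 - cexp (- z) = (1 - expR (- x))%:C + (expR (- x))%:C * ((1 - cos y) +i* sin y).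
  by apply: eqcP; rewrite !cReImE ?(Re_cexp, Im_cexp) /= ?(cReN, cImN) ?(cosN, sinN) -/x -/y; ring.
apply: (le_trans (ler_normcD _ _)).
have e1 : expR (- x) <= 1 by rewrite -expR0 ler_expR oppr_le0.
have e2 := expR_ge1Dx (- x).
rewrite normcM !normc_real !ger0_norm ?expR_ge0 ?subr_ge0//.
have h2 : normc ((1 - cos y) +i* sin y) <= 2 * normc z.
  apply: (le_trans (normc_le_ReIm _)) => /=.
  by have := normr_1Bcos_le y; have := normr_sin_le y; lra.
have h3 : expR (- x) * normc ((1 - cos y) +i* sin y) <= 1 * (2 * normc z).
  by rewrite ler_pM// ?expR_ge0 ?normc_ge0.
by lra.
Qed.

End ComplexNumbers.

(** * Integration of complex functions *)

Section ComplexMeasurable.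
Context {R : realType} {d : measure_display} {T : measurableType d}.
Implicit Types (D : set T) (f g : T -> R[i]).

Definition cmeasurable D f :=
  measurable_fun D (fun t => Re (f t)) /\ measurable_fun D (fun t => Im (f t)).

Lemma cmeasurable_cst D (z : R[i]) : cmeasurable D (fun=> z).
Proof. by split; exact: measurable_cst. Qed.

Lemma cmeasurable_real D (h : T -> R) :
  measurable_fun D h -> cmeasurable D (fun t => (h t)%:C).
Proof. by move=> mh; split => //; exact: measurable_cst. Qed.

Lemma cmeasurableD D f g :
  cmeasurable D f -> cmeasurable D g -> cmeasurable D (fun t => f t + g t).
Proof.
move=> [f1 f2] [g1 g2]; split.
- under eq_fun do rewrite cReD; exact: measurable_funD.
- under eq_fun do rewrite cImD; exact: measurable_funD.
Qed.

Lemma cmeasurableN D f : cmeasurable D f -> cmeasurable D (fun t => - f t).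
Proof.
move=> [f1 f2]; split.
- under eq_fun do rewrite cReN; exact: measurable_funN.
- under eq_fun do rewrite cImN; exact: measurable_funN.
Qed.

Lemma cmeasurableB D f g :
  cmeasurable D f -> cmeasurable D g -> cmeasurable D (fun t => f t - g t).
Proof. by move=> mf mg; apply: cmeasurableD => //; exact: cmeasurableN. Qed.

Lemma cmeasurableM D f g :
  cmeasurable D f -> cmeasurable D g -> cmeasurable D (fun t => f t * g t).
Proof.
move=> [f1 f2] [g1 g2]; split.
- under eq_fun do rewrite cReM.
  by apply: measurable_funB; apply: measurable_funM.
- under eq_fun do rewrite cImM.
  by apply: measurable_funD; apply: measurable_funM.
Qed.

Lemma cmeasurableX D f n :
  cmeasurable D f -> cmeasurable D (fun t => f t ^+ n).
Proof.
move=> mf; elim: n => [|n IH].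
  by under eq_fun do rewrite expr0; exact: cmeasurable_cst.
by under eq_fun do rewrite exprS; exact: cmeasurableM.
Qed.

Lemma cmeasurable_cexp D f : cmeasurable D f -> cmeasurable D (fun t => cexp (f t)).
Proof.
move=> [f1 f2]; split; rewrite /cexp /=.
- apply: measurable_funM; first exact: measurableT_comp.
  apply: (measurableT_comp _ f2); apply: continuous_measurable_fun.
  exact: continuous_cos.
- apply: measurable_funM; first exact: measurableT_comp.
  apply: (measurableT_comp _ f2); apply: continuous_measurable_fun.
  exact: continuous_sin.
Qed.

Lemma measurable_normc D f : cmeasurable D f -> measurable_fun D (fun t => normc (f t)).
Proof.
move=> [f1 f2]; under eq_fun do rewrite normc_ReIm.
apply: (@measurableT_comp _ _ _ _ _ _ (@Num.sqrt R)).
  by apply: continuous_measurable_fun; exact: sqrt_continuous.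
by apply: measurable_funD; apply: measurable_funX.
Qed.

Lemma eq_cmeasurable D f g : {in D, f =1 g} -> cmeasurable D f -> cmeasurable D g.
Proof.
move=> fg [f1 f2]; split.
- by apply: eq_measurable_fun f1 => t Dt; rewrite fg.
- by apply: eq_measurable_fun f2 => t Dt; rewrite fg.
Qed.

End ComplexMeasurable.

Section ComplexIntegration.
Context {R : realType} {d : measure_display} {T : measurableType d}.
Variable mu : {measure set T -> \bar R}.
Variable D : set T.
Hypothesis mD : measurable D.
Implicit Types (f g : T -> R[i]) (h : T -> R).

Lemma cintegrable_measurable f : cintegrable mu D f -> cmeasurable D f.
Proof.
by move=> [/integrableP[/measurable_EFinP f1 _] /integrableP[/measurable_EFinP f2 _]].
Qed.

Lemma le_cintegrable f h : cmeasurable D f -> mu.-integrable D (EFin \o h) ->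
  (forall t, D t -> normc (f t) <= h t) -> cintegrable mu D f.
Proof.
move=> [f1 f2] ih fh; split.
- apply: le_integrable ih => //; first exact/measurable_EFinP.
  move=> t Dt /=; rewrite lee_fin (le_trans (Re_le_normc _))//.
  by rewrite (le_trans (fh _ Dt))// ler_norm.
- apply: le_integrable ih => //; first exact/measurable_EFinP.
  move=> t Dt /=; rewrite lee_fin (le_trans (Im_le_normc _))//.
  by rewrite (le_trans (fh _ Dt))// ler_norm.
Qed.

Lemma integrable_normc f : cintegrable mu D f ->
  mu.-integrable D (EFin \o (fun t => normc (f t))).
Proof.
move=> fi; have mf := cintegrable_measurable fi; case: fi => i1 i2.
have := integrableD mD (integrable_norm i1) (integrable_norm i2).
apply: le_integrable => //; first by apply/measurable_EFinP/measurable_normc.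
move=> t Dt; rewrite /= lee_fin ger0_norm ?normc_ge0// ger0_norm ?addr_ge0//.
exact: normc_le_ReIm.
Qed.

Lemma cintegrable_lty f : cmeasurable D f ->
  (\int[mu]_(t in D) (normc (f t))%:E < +oo)%E -> cintegrable mu D f.
Proof.
move=> mf foo; apply: (@le_cintegrable _ (fun t => normc (f t))) => //.
apply/integrableP; split; first by apply/measurable_EFinP/measurable_normc.
apply: le_lt_trans foo; apply: ge0_le_integral => //=.
- by apply/measurable_EFinP/measurableT_comp => //; exact: measurable_normc.
- by apply/measurable_EFinP/measurable_normc.
- by move=> t _; rewrite lee_fin ger0_norm// normc_ge0.
Qed.

Lemma eq_cintegrable f g : {in D, f =1 g} -> cintegrable mu D f -> cintegrable mu D g.
Proof.
move=> fg [f1 f2]; split.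
- by apply: eq_integrable f1 => // t Dt /=; rewrite fg.
- by apply: eq_integrable f2 => // t Dt /=; rewrite fg.
Qed.

Lemma eq_cintegral f g : {in D, f =1 g} -> cintegral mu D f = cintegral mu D g.
Proof.
by move=> fg; congr Complex; apply: eq_Rintegral => t Dt; rewrite fg.
Qed.

Lemma cintegrableD f g : cintegrable mu D f -> cintegrable mu D g ->
  cintegrable mu D (fun t => f t + g t).
Proof.
move=> [f1 f2] [g1 g2]; split.
- apply: eq_integrable (integrableD mD f1 g1) => // t _ /=.
  by rewrite cReD.
- apply: eq_integrable (integrableD mD f2 g2) => // t _ /=.
  by rewrite cImD.
Qed.

Lemma cintegralD f g : cintegrable mu D f -> cintegrable mu D g ->
  cintegral mu D (fun t => f t + g t) = cintegral mu D f + cintegral mu D g.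
Proof.
move=> [f1 f2] [g1 g2]; apply: eqcP; rewrite cReImE /= -RintegralD//.
- by apply: eq_Rintegral => t _; rewrite cReD.
- by apply: eq_Rintegral => t _; rewrite cImD.
Qed.

Lemma cintegrableZ (z : R[i]) f : cintegrable mu D f ->
  cintegrable mu D (fun t => z * f t).
Proof.
move=> fi; apply: (@le_cintegrable _ (fun t => normc z * normc (f t))).
- apply: cmeasurableM; first exact: cmeasurable_cst.
  exact: cintegrable_measurable.
- have := integrableZl mD (normc z) (integrable_normc fi).
  by apply: eq_integrable => // t _ /=.
- by move=> t _; rewrite normcM.
Qed.

Lemma cintegralZ (z : R[i]) f : cintegrable mu D f ->
  cintegral mu D (fun t => z * f t) = z * cintegral mu D f.
Proof.
move=> [f1 f2].
have i1 (k : R) : mu.-integrable D (EFin \o (fun t => k * Re (f t))).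
  by apply: eq_integrable (integrableZl mD k f1) => // t _ /=.
have i2 (k : R) : mu.-integrable D (EFin \o (fun t => k * Im (f t))).
  by apply: eq_integrable (integrableZl mD k f2) => // t _ /=.
apply: eqcP; rewrite cReImE /= -!RintegralZl//.
- by rewrite -RintegralB//; apply: eq_Rintegral => t _; rewrite cReM.
- by rewrite -RintegralD//; apply: eq_Rintegral => t _; rewrite cImM.
Qed.

Lemma cintegrableB f g : cintegrable mu D f -> cintegrable mu D g ->
  cintegrable mu D (fun t => f t - g t).
Proof.
move=> fi gi.
have -> : (fun t => f t - g t) = (fun t => f t + (- 1) * g t).
  by apply/funext => t; rewrite mulN1r.
by apply: cintegrableD => //; exact: cintegrableZ.
Qed.

Lemma cintegralB f g : cintegrable mu D f -> cintegrable mu D g ->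
  cintegral mu D (fun t => f t - g t) = cintegral mu D f - cintegral mu D g.
Proof.
move=> fi gi.
have -> : (fun t => f t - g t) = (fun t => f t + (- 1) * g t).
  by apply/funext => t; rewrite mulN1r.
rewrite cintegralD//; last exact: cintegrableZ.
by rewrite cintegralZ// mulN1r.
Qed.

Lemma normc_cintegral_le f h : cintegrable mu D f -> mu.-integrable D (EFin \o h) ->
  (forall t, D t -> normc (f t) <= h t) ->
  normc (cintegral mu D f) <= 2 * Rintegral mu D h.
Proof.
move=> [f1 f2] ih fh; apply: (le_trans (normc_le_ReIm _)) => /=.
rewrite mulrDl mul1r; apply: lerD.
- apply: (le_trans (le_normr_Rintegral mD f1)); apply: le_Rintegral => //.
    exact: integrable_norm.
  by move=> t Dt; rewrite (le_trans (Re_le_normc _))// fh.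
- apply: (le_trans (le_normr_Rintegral mD f2)); apply: le_Rintegral => //.
    exact: integrable_norm.
  by move=> t Dt; rewrite (le_trans (Im_le_normc _))// fh.
Qed.

Lemma Rdominated_cvg (u : nat -> T -> R) (v h : T -> R) :
  (forall n, measurable_fun D (u n)) -> mu.-integrable D (EFin \o h) ->
  (forall n t, D t -> `|u n t| <= h t) ->
  (forall t, D t -> u ^~ t @ \oo --> v t) ->
  mu.-integrable D (EFin \o v) /\
  Rintegral mu D (u n) @[n --> \oo] --> Rintegral mu D v.
Proof.
move=> mu_ ih uh uv.
have mv : measurable_fun D v by exact: measurable_fun_cvg uv.
have [] := @dominated_convergence _ _ _ mu D mD (fun n => EFin \o u n) (EFin \o v)
  (EFin \o h).
- by move=> n; exact/measurable_EFinP.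
- exact/measurable_EFinP.
- apply: aeW => t Dt /=; apply/cvg_EFin; first exact: nearW.
  exact: uv.
- exact: ih.
- by apply: aeW => t n Dt /=; rewrite lee_fin uh.
move=> iv _ uvi; split=> //.
rewrite /Rintegral; apply: fine_cvg.
by rewrite fineK//; exact: integrable_fin_num.
Qed.

Lemma cdominated_cvg (f_ : nat -> T -> R[i]) f h :
  (forall n, cmeasurable D (f_ n)) -> mu.-integrable D (EFin \o h) ->
  (forall n t, D t -> normc (f_ n t) <= h t) ->
  (forall t, D t -> (fun n => Re (f_ n t)) @ \oo --> Re (f t)) ->
  (forall t, D t -> (fun n => Im (f_ n t)) @ \oo --> Im (f t)) ->
  [/\ cintegrable mu D f,
    Re (cintegral mu D (f_ n)) @[n --> \oo] --> Re (cintegral mu D f) &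
    Im (cintegral mu D (f_ n)) @[n --> \oo] --> Im (cintegral mu D f)].
Proof.
move=> mf ih fh f1 f2.
have [i1 c1] := @Rdominated_cvg (fun n t => Re (f_ n t)) (fun t => Re (f t)) h
  (fun n => (mf n).1) ih
  (fun n t Dt => le_trans (Re_le_normc _) (fh n t Dt)) f1.
have [i2 c2] := @Rdominated_cvg (fun n t => Im (f_ n t)) (fun t => Im (f t)) h
  (fun n => (mf n).2) ih
  (fun n t Dt => le_trans (Im_le_normc _) (fh n t Dt)) f2.
by split.
Qed.

End ComplexIntegration.

(** * Absolutely convergent series and termwise integration *)

Section AbsoluteSeries.
Context {R : realType}.
Implicit Types (u : nat -> R[i]).

(** One majorant controls the partial sums and the limit alike; the former is
what dominated convergence of a series of functions requires. *)
Lemma series_dominated (v a : nat -> R) : (forall n, `|v n| <= a n) ->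
  (\sum_(n <oo) (a n)%:E < +oo)%E ->
  [/\ cvgn (series v), forall n, `|series v n| <= fine (\sum_(n <oo) (a n)%:E)%E &
   `|limn (series v)| <= fine (\sum_(n <oo) (a n)%:E)%E].
Proof.
move=> va aoo; set M := fine _.
have a0 n : 0 <= a n := le_trans (normr_ge0 _) (va n).
have EM : (\sum_(n <oo) (a n)%:E)%E = M%:E.
  by rewrite fineK// ge0_fin_numE// nneseries_ge0// => n _ _; rewrite lee_fin.
have aM n : series a n <= M.
  rewrite -lee_fin -EM /series/= -sumEFin.
  by apply: nneseries_lim_ge => k _ _; rewrite lee_fin.
have ca : cvgn (series a).
  apply: nondecreasing_is_cvgn.
    by apply: nondecreasing_series => n _ _; exact: a0.
  by exists M => _ [n _ <-]; exact: aM.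
have cv : cvgn [normed series v].
  by apply: series_le_cvg ca => // n; exact: normr_ge0.
have vM n : `|series v n| <= M.
  apply: le_trans (aM n); apply: (le_trans (ler_norm_sum _ _ _)).
  by apply: ler_sum => i _; exact: va.
split => //; first exact: normed_cvg.
have := normed_cvg cv => /cvg_norm cl.
rewrite -(cvg_lim _ cl)//; apply: limr_le; first by apply/cvg_ex; eexists; exact: cl.
by apply: nearW => n; exact: vM.
Qed.

Lemma cseries_dominated u (a : nat -> R) : (forall n, normc (u n) <= a n) ->
  (\sum_(n <oo) (a n)%:E < +oo)%E ->
  [/\ cvgn (series (fun n => Re (u n))), cvgn (series (fun n => Im (u n))),
   forall n, normc (\sum_(k < n) u k) <= 2 * fine (\sum_(n <oo) (a n)%:E)%E &
   normc (cseries u) <= 2 * fine (\sum_(n <oo) (a n)%:E)%E].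
Proof.
move=> ua aoo.
have [c1 p1 l1] := series_dominated (fun n => le_trans (Re_le_normc _) (ua n)) aoo.
have [c2 p2 l2] := series_dominated (fun n => le_trans (Im_le_normc _) (ua n)) aoo.
split=> //; last first.
  by apply: (le_trans (normc_le_ReIm _)); rewrite mulrDl mul1r lerD.
move=> n; apply: (le_trans (normc_le_ReIm _)); rewrite cRe_sum cIm_sum mulrDl mul1r.
rewrite -(big_mkord xpredT (fun k => Re (u k))) -(big_mkord xpredT (fun k => Im (u k))).
exact: lerD (p1 n) (p2 n).
Qed.

Lemma normc_cseries_le u : (\sum_(n <oo) (normc (u n))%:E < +oo)%E ->
  ((normc (cseries u))%:E <= 2%:E * \sum_(n <oo) (normc (u n))%:E)%E.
Proof.
move=> uoo; have [_ _ _ h] := cseries_dominated (fun n => lexx _) uoo.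
apply: (le_trans (_ : (_ <= (2 * fine (\sum_(n <oo) (normc (u n))%:E)%E)%:E)%E)).
  by rewrite lee_fin.
rewrite EFinM fineK// ge0_fin_numE// nneseries_ge0// => n _ _.
by rewrite lee_fin normc_ge0.
Qed.

Lemma cseriesZ (z : R[i]) u : (\sum_(n <oo) (normc (u n))%:E < +oo)%E ->
  cseries (fun n => z * u n) = z * cseries u.
Proof.
move=> uoo; have [c1 c2 _ _] := cseries_dominated (fun n => lexx _) uoo.
have lZ (k : R) (f : nat -> R) : cvgn (series f) ->
  k * limn (series f) = limn (series (k *: f)) by move=> cf; rewrite lim_seriesZ.
apply: eqcP; rewrite cReImE /=.
- rewrite !lZ// -lim_seriesB; [|exact: is_cvg_seriesZ..].
  by congr (limn (series _)); apply/funext => n; rewrite cReM.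
- rewrite !lZ// -lim_seriesD; [|exact: is_cvg_seriesZ..].
  by congr (limn (series _)); apply/funext => n; rewrite cImM.
Qed.

(** Sums of nonnegative terms over pairs are iterated sums. *)
Lemma abs_cvg2E (c : nat -> nat -> R[i]) :
  abs_cvg2 c <-> (\sum_(m <oo) \sum_(n <oo) (normc (c m n))%:E < +oo)%E.
Proof.
have E : (\sum_(m <oo) \sum_(n <oo) (normc (c m n))%:E =
    \esum_(k in [set: nat * nat]) `|(normc (c k.1 k.2))%:E|)%E.
  rewrite nneseries_esumT; last first.
    by move=> n; apply: nneseries_ge0 => m _ _; rewrite lee_fin normc_ge0.
  rewrite (eq_esum (b := fun m => \esum_(n in [set: nat]) (normc (c m n))%:E)%E); last first.
    move=> m _; apply: nneseries_esumT => n.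
    by rewrite lee_fin normc_ge0.
  rewrite esum_esum; last by move=> *; rewrite lee_fin normc_ge0.
  have -> : ([set: nat] `*`` (fun=> [set: nat])) = [set: nat * nat].
    by apply/seteqP; split => // -[].
  by apply: eq_esum => k _ /=; rewrite ger0_norm// normc_ge0.
by rewrite E.
Qed.

Lemma abs_cvg2_row (c : nat -> nat -> R[i]) : abs_cvg2 c ->
  forall m, (\sum_(n <oo) (normc (c m n))%:E < +oo)%E.
Proof.
move=> /abs_cvg2E coo m; apply: le_lt_trans coo.
have h k : (0 <= \sum_(n <oo) (normc (c k n))%:E)%E.
  by apply: nneseries_ge0 => n _ _; rewrite lee_fin normc_ge0.
apply: le_trans (@nneseries_lim_ge _ _ xpredT 0%N m.+1 (fun k _ _ => h k)).
rewrite big_mkord big_ord_recr /= leeDr//.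
by apply: sume_ge0 => k _.
Qed.

Lemma abs_cvg2_outer (c : nat -> nat -> R[i]) : abs_cvg2 c ->
  (\sum_(m <oo) (normc (cseries (c m)))%:E < +oo)%E.
Proof.
move=> coo; have crow := abs_cvg2_row coo; move/abs_cvg2E : coo => coo.
apply: (@le_lt_trans _ _ (\sum_(m <oo) (2%:E * \sum_(n <oo) (normc (c m n))%:E))%E).
  apply: lee_nneseries => m _; first by rewrite lee_fin normc_ge0.
  exact: normc_cseries_le.
rewrite nneseriesZl; last first.
  by move=> m _; apply: nneseries_ge0 => n _ _; rewrite lee_fin normc_ge0.
by rewrite lte_mul_pinfty.
Qed.

Lemma eq_cseries2 (b c : nat -> nat -> R[i]) :
  (forall m n, b m n = c m n) -> cseries2 b = cseries2 c.
Proof.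
by move=> bc; congr cseries2; apply/funext => m; apply/funext => n.
Qed.

Lemma cseries2Z (z : R[i]) c : abs_cvg2 c ->
  cseries2 (fun m n => z * c m n) = z * cseries2 c.
Proof.
move=> coo; rewrite /cseries2 -cseriesZ; last exact: abs_cvg2_outer.
congr cseries; apply/funext => m; apply: cseriesZ; exact: abs_cvg2_row.
Qed.

Lemma le_abs_cvg2 (b c : nat -> nat -> R[i]) (K : R) : 0 <= K ->
  (forall m n, normc (b m n) <= K * normc (c m n)) -> abs_cvg2 c -> abs_cvg2 b.
Proof.
move=> K0 bc /abs_cvg2E coo; apply/abs_cvg2E.
have n0 (a : nat -> nat -> R[i]) m : (0 <= \sum_(n <oo) (normc (a m n))%:E)%E.
  by apply: nneseries_ge0 => n _ _; rewrite lee_fin normc_ge0.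
apply: (@le_lt_trans _ _ (\sum_(m <oo) (K%:E * \sum_(n <oo) (normc (c m n))%:E))%E).
  apply: lee_nneseries => m _ //; rewrite -nneseriesZl; last first.
    by move=> n _; rewrite lee_fin normc_ge0.
  by apply: lee_nneseries => n _; rewrite -?EFinM lee_fin ?normc_ge0.
by rewrite nneseriesZl//; exact: lte_mul_pinfty.
Qed.

End AbsoluteSeries.

Section TermwiseIntegration.
Context {R : realType} {d : measure_display} {T : measurableType d}.
Variable mu : {measure set T -> \bar R}.
Variable D : set T.
Hypothesis mD : measurable D.

(** The sum of the moduli is integrable by monotone convergence and dominates
the partial sums. *)
Lemma cintegral_cseries (f_ : nat -> T -> R[i]) :
  (forall n, cmeasurable D (f_ n)) ->
  (forall t, D t -> \sum_(n <oo) (normc (f_ n t))%:E < +oo)%E ->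
  (\sum_(n <oo) \int[mu]_(t in D) (normc (f_ n t))%:E < +oo)%E ->
  [/\ cintegrable mu D (fun t => cseries (f_ ^~ t)),
   cintegral mu D (fun t => cseries (f_ ^~ t)) = cseries (fun n => cintegral mu D (f_ n)) &
   (\int[mu]_(t in D) (normc (cseries (f_ ^~ t)))%:E <=
    2%:E * \sum_(n <oo) \int[mu]_(t in D) (normc (f_ n t))%:E)%E].
Proof.
move=> mf foo ioo.
have mnf n : measurable_fun D (fun t => (normc (f_ n t))%:E).
  exact/measurable_EFinP/measurable_normc.
have nf0 n t : D t -> (0 <= (normc (f_ n t))%:E)%E.
  by move=> _; rewrite lee_fin normc_ge0.
have nneg t : (0 <= \sum_(n <oo) (normc (f_ n t))%:E)%E.
  by apply: nneseries_ge0 => n _ _; rewrite lee_fin normc_ge0.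
have fi n : cintegrable mu D (f_ n).
  apply: cintegrable_lty => //; apply: le_lt_trans ioo.
  have h k : (0 <= \int[mu]_(t in D) (normc (f_ k t))%:E)%E.
    by apply: integral_ge0 => t Dt; exact: nf0.
  apply: le_trans (@nneseries_lim_ge _ _ xpredT 0%N n.+1 (fun k _ _ => h k)).
  by rewrite big_mkord big_ord_recr /= leeDr//; apply: sume_ge0 => k _.
pose h t := fine (\sum_(n <oo) (normc (f_ n t))%:E)%E.
have hE t : D t -> ((h t)%:E = \sum_(n <oo) (normc (f_ n t))%:E)%E.
  by move=> Dt; rewrite fineK// ge0_fin_numE// foo.
have ms : measurable_fun D (fun t => \sum_(n <oo) (normc (f_ n t))%:E)%E.
  by apply: ge0_emeasurable_sum => // n t Dt _; exact: nf0.
have ih : mu.-integrable D (EFin \o h).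
  apply/integrableP; split.
    by apply: eq_measurable_fun ms => t /set_mem Dt /=; rewrite hE.
  rewrite (eq_integral (fun t => \sum_(n <oo) (normc (f_ n t))%:E)%E).
    by rewrite integral_nneseries.
  by move=> t /set_mem Dt /=; rewrite -hE//= ger0_norm// -lee_fin hE.
have ih2 : mu.-integrable D (EFin \o (fun t => 2 * h t)).
  by apply: eq_integrable (integrableZl mD 2 ih) => // t _ /=.
pose S n t := \sum_(k < n) f_ k t.
have mS n : cmeasurable D (S n).
  elim: n => [|n IH].
    by apply: eq_cmeasurable (cmeasurable_cst _ 0) => t _; rewrite /S big_ord0.
  apply: eq_cmeasurable (cmeasurableD IH (mf n)) => t _.
  by rewrite /S big_ord_recr.
have iS n : cintegrable mu D (S n) /\ cintegral mu D (S n) = \sum_(k < n) cintegral mu D (f_ k).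
  elim: n => [|n [IH1 IH2]].
    have E : S 0%N = (fun t => 0 * f_ 0%N t).
      by apply/funext => t; rewrite /S big_ord0 mul0r.
    by rewrite E cintegralZ// mul0r big_ord0; split => //; exact: cintegrableZ.
  have E : S n.+1 = (fun t => S n t + f_ n t).
    by apply/funext => t; rewrite /S big_ord_recr.
  by rewrite E cintegralD// IH2 big_ord_recr; split => //; exact: cintegrableD.
have dom t : D t -> _ := fun Dt => cseries_dominated (fun n => lexx _) (foo t Dt).
have bS n t : D t -> normc (S n t) <= 2 * h t by move=> Dt; have [_ _ h4 _] := dom t Dt; exact: h4.
have cS1 t : D t -> (fun n => Re (S n t)) @ \oo --> Re (cseries (f_ ^~ t)).
  move=> Dt; have [+ _ _ _] := dom t Dt.
  suff -> : (fun n => Re (S n t)) = series (fun n => Re (f_ n t)) by [].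
  by apply/funext => n; rewrite /S (cRe_sum n (f_ ^~ t)) /series/= big_mkord.
have cS2 t : D t -> (fun n => Im (S n t)) @ \oo --> Im (cseries (f_ ^~ t)).
  move=> Dt; have [_ + _ _] := dom t Dt.
  suff -> : (fun n => Im (S n t)) = series (fun n => Im (f_ n t)) by [].
  by apply/funext => n; rewrite /S (cIm_sum n (f_ ^~ t)) /series/= big_mkord.
have [i1 c1 c2] := cdominated_cvg mD mS ih2 bS cS1 cS2.
split => //.
  apply: eqcP => /=.
  + apply/esym/cvg_lim => //.
    suff <- : (fun n => Re (cintegral mu D (S n))) =
      series (fun n => Re (cintegral mu D (f_ n))) by [].
    by apply/funext => n; rewrite (iS n).2 (cRe_sum n (fun k => cintegral mu D (f_ k))) /series/= big_mkord.
  + apply/esym/cvg_lim => //.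
    suff <- : (fun n => Im (cintegral mu D (S n))) =
      series (fun n => Im (cintegral mu D (f_ n))) by [].
    by apply/funext => n; rewrite (iS n).2 (cIm_sum n (fun k => cintegral mu D (f_ k))) /series/= big_mkord.
apply: (@le_trans _ _ (\int[mu]_(t in D) (2 * h t)%:E)%E).
  apply: ge0_le_integral => //.
  + by move=> t _; rewrite lee_fin normc_ge0.
  + exact/measurable_EFinP/measurable_normc/(cintegrable_measurable i1).
  + by case/integrableP : ih2.
  + by move=> t Dt; rewrite lee_fin; have [] := dom t Dt.
rewrite -integral_nneseries// -(@integralZl _ _ _ mu D mD)//; last first.
  by apply: eq_integrable ih => // t /set_mem Dt /=; exact: hE.
rewrite le_eqVlt; apply/orP; left; apply/eqP.
by apply: eq_integral => t /set_mem Dt; rewrite EFinM hE.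
Qed.

(** The inner sums satisfy the hypotheses of the single-series statement, up to
a factor [2] in the bounds. *)
Lemma cintegral_cseries2 (f_ : nat -> nat -> T -> R[i]) :
  (forall m n, cmeasurable D (f_ m n)) ->
  (forall t, D t -> abs_cvg2 (fun m n => f_ m n t)) ->
  (\sum_(m <oo) \sum_(n <oo) \int[mu]_(t in D) (normc (f_ m n t))%:E < +oo)%E ->
  cintegrable mu D (fun t => cseries2 (fun m n => f_ m n t)) /\
  cintegral mu D (fun t => cseries2 (fun m n => f_ m n t)) =
    cseries2 (fun m n => cintegral mu D (f_ m n)).
Proof.
move=> mf foo ioo.
have i0 m : (0 <= \sum_(n <oo) \int[mu]_(t in D) (normc (f_ m n t))%:E)%E.
  by apply: nneseries_ge0 => n _ _; apply: integral_ge0 => t _; rewrite lee_fin normc_ge0.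
have irow m : (\sum_(n <oo) \int[mu]_(t in D) (normc (f_ m n t))%:E < +oo)%E.
  apply: le_lt_trans ioo.
  apply: le_trans (@nneseries_lim_ge _ _ xpredT 0%N m.+1 (fun k _ _ => i0 k)).
  by rewrite big_mkord big_ord_recr /= leeDr//; apply: sume_ge0 => k _.
have inner m := @cintegral_cseries (f_ m) (mf m)
  (fun t Dt => abs_cvg2_row (foo t Dt) m) (irow m).
have [] := @cintegral_cseries (fun m t => cseries (fun n => f_ m n t)).
- by move=> m; have [/cintegrable_measurable] := inner m.
- by move=> t Dt; exact: abs_cvg2_outer (foo t Dt).
- apply: (@le_lt_trans _ _ (\sum_(m <oo)
    (2%:E * \sum_(n <oo) \int[mu]_(t in D) (normc (f_ m n t))%:E))%E).
    apply: lee_nneseries => [m _ _|m _]; last by have [] := inner m.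
    by apply: integral_ge0 => t _; rewrite lee_fin normc_ge0.
  by rewrite nneseriesZl//; exact: lte_mul_pinfty.
move=> i e _; split => //; rewrite e /cseries2; congr cseries.
by apply/funext => m; have [] := inner m.
Qed.

End TermwiseIntegration.

(** * Integrability of the Gamma density *)

Section GammaDensity.
Context {R : realType}.
Implicit Types (s a t : R).
Local Notation leb := (@lebesgue_measure R).

(** The modulus of [t ^ (w - 1) * exp (- p t)] for [s = Re w] and [a = Re p],
written with a single exponential so that exponents add up. *)
Definition gdens s a t := expR ((s - 1) * ln t - a * t).

Lemma gdens_gt0 s a t : 0 < gdens s a t. Proof. exact: expR_gt0. Qed.

Lemma measurable_gdens s a D : measurable_fun D (gdens s a).
Proof.
apply: measurable_funTS; apply: (measurableT_comp (@measurable_expR R)).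
by apply: measurable_funB; apply: measurable_funM.
Qed.

(** A power grows slower than an exponential: the maximum of
[s log t - a t] is at [t = s / a]. *)
Lemma expR_ln_le s a t : 0 < s -> 0 < a -> 0 < t ->
  expR (s * ln t) <= expR (s * ln (s / a)) * expR (a * t).
Proof.
move=> s0 a0 t0; rewrite -expRD ler_expR.
have -> : ln t = ln (s / a) + ln (a * t / s).
  rewrite -lnM ?posrE ?divr_gt0 ?mulr_gt0//; congr ln.
  by field; rewrite !gt_eqF.
rewrite mulrDr lerD2l.
have ats : 0 < a * t / s by rewrite divr_gt0// mulr_gt0.
have h : ln (a * t / s) <= a * t / s - 1.
  have -> : a * t / s = 1 + (a * t / s - 1) by lra.
  by rewrite (le_trans (le_ln1Dx _))//; lra.
apply: (le_trans (ler_wpM2l (ltW s0) h)).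
have -> : s * (a * t / s - 1) = a * t - s by field; rewrite gt_eqF.
by lra.
Qed.

(** The derivative of [- 1 / (1 + t ^ s)]: comparable to [t ^ (s - 1)] at the
origin and with bounded primitive, it dominates [gdens s a]. *)
Let kern s t : R := (1 + t `^ s) ^- 2 * (s * t `^ (s - 1)).

Let kernE s t : 0 < t -> is_derive t 1 (fun u : R => - (1 + u `^ s)^-1) (kern s t).
Proof.
move=> t0; have d1 := is_derive1_powR s t0.
have n0 : 1 + t `^ s != 0 by rewrite gt_eqF// ltr_pwDl// powR_ge0.
have d2 : is_derive t 1 (fun u : R => 1 + u `^ s) (s * t `^ (s - 1)).
  by have := is_deriveD (is_derive_cst (1 : R) t 1) d1; rewrite add0r.
have := is_deriveN (is_deriveV (f := fun u : R => 1 + u `^ s) n0 d2).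
by rewrite scaleNr opprK.
Qed.

Let kern_cont s t : 0 < t -> {for t, continuous (kern s)}.
Proof.
move=> t0.
have c (r : R) : {for t, continuous (fun u : R => u `^ r)}.
  apply: differentiable_continuous; apply/derivable1_diffP.
  by have [] := is_derive1_powR r t0.
have n0 : 1 + t `^ s != 0 by rewrite gt_eqF// ltr_pwDl// powR_ge0.
have c1 : {for t, continuous (fun u : R => 1 + u `^ s)}.
  by apply: cvgD; [exact: cvg_cst|exact: c].
apply: cvgM; last by apply: cvgM; [exact: cvg_cst|exact: c].
apply: cvgV; first by rewrite expf_neq0.
have -> : (fun u : R => (1 + u `^ s) ^+ 2) = (fun u => (1 + u `^ s) * (1 + u `^ s)).
  by apply/funext => u; rewrite expr2.
by rewrite expr2; apply: cvgM; exact: c1.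
Qed.

Let kern_int s (x y : R) : 0 < s -> 0 < x -> x < y ->
  (\int[leb]_(t in `[x, y]) (kern s t)%:E <= 1)%E.
Proof.
move=> s0 x0 xy.
rewrite (@continuous_FTC2 _ _ (fun u : R => - (1 + u `^ s)^-1))//.
- rewrite -EFinB lee_fin opprK.
  have h (u : R) : 0 <= (1 + u `^ s)^-1 <= 1.
    have p : 1 <= 1 + u `^ s by rewrite lerDl powR_ge0.
    rewrite invr_ge0 (le_trans ler01 p)/= invf_le1//.
    exact: lt_le_trans ltr01 p.
  by have := h x; have := h y; lra.
- apply: continuous_in_subspaceT => t; rewrite inE/= in_itv/= => /andP[xt _].
  by apply: kern_cont; exact: lt_le_trans xt.
- have c (u : R) : 0 < u -> {for u, continuous (fun u : R => - (1 + u `^ s)^-1)}.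
    move=> u0; apply: differentiable_continuous; apply/derivable1_diffP.
    by have [] := kernE s u0.
  split.
  + move=> u; rewrite in_itv/= => /andP[xu _].
    by have [] := kernE s (lt_trans x0 xu).
  + by apply: cvg_at_right_filter; apply: c.
  + by apply: cvg_at_left_filter; apply: c; exact: lt_trans xy.
- move=> u; rewrite in_itv/= => /andP[xu _].
  have d := kernE s (lt_trans x0 xu).
  by rewrite derive1E derive_val.
Qed.

Let gdens_kern s a : 0 < s -> 0 < a ->
  exists2 C : R, 0 <= C & forall t, 0 < t -> gdens s a t <= C * kern s t.
Proof.
move=> s0 a0; have a20 : 0 < a / 2 by rewrite divr_gt0.
set B := expR (s * ln (s / (a / 2))).
have B0 : 0 < B := expR_gt0 _.
exists ((1 + B) ^+ 2 / s); first by rewrite divr_ge0 ?sqr_ge0// ltW.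
move=> t t0; rewrite /kern /gdens.
have -> : t `^ (s - 1) = expR ((s - 1) * ln t) by rewrite /powR gt_eqF.
have -> : t `^ s = expR (s * ln t) by rewrite /powR gt_eqF.
set X := expR (s * ln t); have X0 : 0 < X := expR_gt0 _.
set E := expR (a / 2 * t).
have XE : X <= B * E by apply: expR_ln_le.
have E1 : 1 <= E by rewrite -expR0 ler_expR mulr_ge0 ?ltW.
rewrite expRB; have -> : expR (a * t) = E ^+ 2.
  by rewrite /E -expRM_natl; congr expR; lra.
set Y := expR ((s - 1) * ln t); have Y0 : 0 < Y := expR_gt0 _.
have XE2 : 1 + X <= (1 + B) * E by lra.
have sn : s != 0 by rewrite gt_eqF.
have Xn : 1 + X != 0 by rewrite gt_eqF//; lra.
have -> : (1 + B) ^+ 2 / s * ((1 + X) ^- 2 * (s * Y)) = (1 + B) ^+ 2 / (1 + X) ^+ 2 * Y.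
  by field; rewrite sn Xn.
rewrite mulrC ler_wpM2r ?(ltW Y0)//.
have X10 : 0 < 1 + X by lra.
rewrite ler_pdivlMr ?exprn_gt0// mulrC ler_pdivrMr ?exprn_gt0 ?expR_gt0//.
rewrite -exprMn lerXn2r ?nnegrE//; first by lra.
by rewrite mulr_ge0 ?expR_ge0//; lra.
Qed.

(** The integrals over [[1 / n, n]] are bounded by the total variation of
[- 1 / (1 + t ^ s)], uniformly in [n]. *)
Lemma integrable_gdens s a : 0 < s -> 0 < a ->
  leb.-integrable `]0, +oo[ (EFin \o gdens s a).
Proof.
move=> s0 a0; have [C C0 gC] := gdens_kern s0 a0.
apply/integrableP; split; first by apply/measurable_EFinP; exact: measurable_gdens.
under eq_integral do rewrite /= (ger0_norm (ltW (gdens_gt0 _ _ _))).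
pose F (n : nat) : set R := `[n.+2%:R^-1, n.+2%:R]%classic.
have UF : `]0, +oo[%classic = \bigcup_n F n.
  apply/seteqP; split => t /=; rewrite ?in_itv/= ?andbT.
    move=> t0; pose n := maxn (Num.truncn t) (Num.truncn t^-1).
    have h (u : R) : 0 < u -> (Num.truncn u <= n)%N -> u <= n.+2%:R.
      move=> u0 un; apply: (le_trans (ltW (truncnS_gt u))).
      by rewrite ler_nat ltnS (leq_trans un).
    exists n => //; rewrite /F /= in_itv/=; apply/andP; split.
      rewrite -[leRHS]invrK lef_pV2 ?posrE ?invr_gt0 ?ltr0n//.
      by apply: h; rewrite ?invr_gt0// leq_maxr.
    by apply: h; rewrite // leq_maxl.
  by move=> [n _]; rewrite /F /= in_itv/= => /andP[+ _]; apply: lt_le_trans; rewrite invr_gt0 ltr0n.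
have FS m n : (m <= n)%N -> F m `<=` F n.
  move=> mn t; rewrite /F /= !in_itv/= => /andP[h1 h2]; apply/andP; split.
    by apply: le_trans h1; rewrite lef_pV2 ?posrE ?ltr0n// ler_nat !ltnS.
  by apply: (le_trans h2); rewrite ler_nat !ltnS.
have F0 n t : F n t -> 0 < t.
  by rewrite /F /= in_itv/= => /andP[+ _]; apply: lt_le_trans; rewrite invr_gt0 ltr0n.
rewrite UF; apply: (@le_lt_trans _ _ C%:E); last exact: ltry.
have : (\int[leb]_(t in F n) (gdens s a t)%:E)%E @[n --> \oo] -->
  (\int[leb]_(t in \bigcup_n F n) (gdens s a t)%:E)%E.
  apply: ge0_nondecreasing_set_cvg_integral.
  - by move=> m n mn; apply/subsetPset; exact: FS.
  - by move=> n; exact: measurable_itv.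
  - by move=> n; apply/measurable_EFinP; exact: measurable_gdens.
  - by move=> n t _; rewrite lee_fin ltW ?gdens_gt0.
move=> /cvg_lim <-//; apply: lime_le.
  apply: ereal_nondecreasing_is_cvgn => m n mn.
  apply: ge0_subset_integral; [exact: measurable_itv|exact: measurable_itv|..].
  - by apply/measurable_EFinP; exact: measurable_gdens.
  - by move=> t _; rewrite lee_fin ltW ?gdens_gt0.
  - exact: FS.
apply: nearW => n.
have mk : measurable_fun (F n) (kern s).
  apply: subspace_continuous_measurable_fun; first exact: measurable_itv.
  apply: continuous_in_subspaceT => t /set_mem Ft.
  by apply: kern_cont; exact: F0 Ft.
have k0 t : 0 <= kern s t.
  by rewrite /kern mulr_ge0 ?invr_ge0 ?sqr_ge0// mulr_ge0 ?(ltW s0)// powR_ge0.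
apply: (@le_trans _ _ (\int[leb]_(t in F n) (C%:E * (kern s t)%:E))%E).
  apply: ge0_le_integral; [exact: measurable_itv|..].
  - by move=> t _; rewrite lee_fin ltW ?gdens_gt0.
  - by apply/measurable_EFinP; exact: measurable_gdens.
  - by apply/measurable_EFinP/measurable_funM.
  - by move=> t Ft; rewrite -EFinM lee_fin gC// (F0 _ _ Ft).
rewrite ge0_integralZl//; last 3 first.
  - exact: measurable_itv.
  - exact/measurable_EFinP.
  - by move=> t _; rewrite lee_fin.
rewrite -[leRHS]mule1; apply: lee_wpmul2l; first by rewrite lee_fin.
apply: kern_int => //.
by rewrite (@lt_trans _ _ 1) ?invf_lt1 ?ltr1n ?ltr0n.
Qed.

End GammaDensity.

(** * Dilations of Lebesgue measure on the half-line *)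

Section Scaling.
Context {R : realType}.
Local Notation leb := (@lebesgue_measure R).
Local Notation D := (`]0, +oo[%classic : set R).

Let mscaling (s : R) : measurable_fun (T := measurableTypeR R)
  (U := measurableTypeR R) setT (fun t : R => s * t).
Proof. exact: measurable_funM. Qed.

(** The canonical measure structure is named because its measurability argument
cannot be inferred from the function. *)
Let image_scale (s : R) : {measure set (measurableTypeR R) -> \bar R} :=
  measure_function_pushforward__canonical__measure_function_Measure leb (@mscaling s).

Lemma lebesgue_measure_scale (s : R) (s0 : 0 < s) (A : set R) : measurable A ->
  leb A = mscale (NngNum (ltW s0)) (image_scale s) A.
Proof.
move: A; apply: (@lebesgue_measure_unique R
  (mscale (NngNum (ltW s0)) (image_scale s))).
move=> _ /ocitvP[->|[[a b] /= ab ->]]; first by rewrite !measure0.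
have E : (fun t : R => s * t) @^-1` `]a, b]%classic = `]a / s, b / s]%classic.
  apply/seteqP; split => t /=; rewrite !in_itv/= ltr_pdivrMr// ler_pdivlMr//;
    by rewrite ![t * s]mulrC.
transitivity (s%:E * leb (`](a / s)%R, (b / s)%R]%classic : set R))%E.
  rewrite !lebesgue_measure_itv/= !lte_fin ab ltr_pM2r ?invr_gt0// ab.
  rewrite -!EFinB -EFinM; congr EFin; rewrite -mulrBl mulrC divfK//.
  by rewrite gt_eqF.
by rewrite -E.
Qed.

Lemma ge0_integral_scale (s : R) (g : R -> \bar R) : 0 < s ->
  measurable_fun D g -> (forall t, D t -> 0 <= g t)%E ->
  (\int[leb]_(t in D) g t = s%:E * \int[leb]_(t in D) g (s * t)%R)%E.
Proof.
move=> s0 mg g0.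
have DE : (fun t : R => s * t) @^-1` D = D.
  by apply/seteqP; split => t /=; rewrite !in_itv/= !andbT pmulr_rgt0.
rewrite (eq_measure_integral (mscale (NngNum (ltW s0))
  (image_scale s))); last first.
  by move=> A mA _; exact: lebesgue_measure_scale.
rewrite ge0_integral_mscale//; congr (_ * _)%E.
rewrite (ge0_integral_pushforward (@mscaling s)) ?DE//.
by move=> t /set_mem; exact: g0.
Qed.

Lemma Rintegral_scale (s : R) (f : R -> R) : 0 < s ->
  leb.-integrable D (EFin \o f) -> leb.-integrable D (EFin \o (fun t => f (s * t))) ->
  Rintegral leb D f = s * Rintegral leb D (fun t => f (s * t)).
Proof.
move=> s0 fi fsi.
rewrite /Rintegral -[X in X * _]/(fine s%:E) -fineM//; last exact: integrable_fin_num.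
congr fine.
have mD : measurable D by exact: measurable_itv.
have mf : measurable_fun D (EFin \o f) by case/integrableP : fi.
rewrite integralE [in RHS]integralE.
rewrite (ge0_integral_scale s0 (measurable_funepos mf)) => [|t _]; last exact: funepos_ge0.
rewrite (ge0_integral_scale s0 (measurable_funeneg mf)) => [|t _]; last exact: funeneg_ge0.
rewrite [RHS]muleBr//; last first.
  apply: fin_num_adde_defl; rewrite fin_numN.
  exact: integrable_neg_fin_num.
by congr (_ * _ - _ * _)%E; apply: eq_integral => t _; rewrite ?funeposE ?funenegE.
Qed.

Lemma cintegral_scale (s : R) (f : R -> R[i]) : 0 < s ->
  cintegrable leb D f -> cintegrable leb D (fun t => f (s * t)) ->
  cintegral leb D f = s%:C * cintegral leb D (fun t => f (s * t)).
Proof.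
move=> s0 [f1 f2] [g1 g2]; apply: eqcP; rewrite cReImE /=.
- exact: (@Rintegral_scale s (fun t => Re (f t))).
- exact: (@Rintegral_scale s (fun t => Im (f t))).
Qed.

End Scaling.

(** * Principal powers *)

Section Powers.
Context {R : realType}.
Implicit Types (z w p : R[i]) (t s : R).

Lemma clog_real t : 0 < t -> clog t%:C = (ln t)%:C.
Proof.
move=> t0; rewrite /clog /carg normc_real ger0_norm ?(ltW t0)//=.
by rewrite lexx divff ?gt_eqF// acos1.
Qed.

Lemma cpow_real t w : 0 < t -> cpow t%:C w = cexp (w * (ln t)%:C).
Proof. by move=> t0; rewrite /cpow clog_real. Qed.

Lemma Re_div_normc_itv p : 0 < normc p -> -1 <= Re p / normc p <= 1.
Proof.
move=> p0; have := Re_le_normc p; rewrite ler_norml => /andP[h1 h2].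
by rewrite ler_pdivlMr// ler_pdivrMr// mul1r mulN1r h1.
Qed.

Lemma cos_carg p : p != 0 -> cos (carg p) = Re p / normc p.
Proof.
rewrite -normc_gt0 => p0.
have x1 := Re_div_normc_itv p0.
by rewrite /carg; case: ifP => _; rewrite ?cosN acosK// in_itv.
Qed.

Lemma cexp_clog p : p != 0 -> cexp (clog p) = p.
Proof.
move=> pn0; have p0 : 0 < normc p by rewrite normc_gt0.
have x1 := Re_div_normc_itv p0.
have E : expR (ln (normc p)) = normc p by rewrite lnK.
apply: eqcP; rewrite ?(Re_cexp, Im_cexp)/= E.
  by rewrite cos_carg// mulrC divfK// gt_eqF.
have sE : Num.sqrt (1 - (Re p / normc p) ^+ 2) = `|Im p| / normc p.
  have -> : 1 - (Re p / normc p) ^+ 2 = (`|Im p| / normc p) ^+ 2.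
    rewrite !expr_div_n real_normK ?num_real//.
    have -> : Im p ^+ 2 = normc p ^+ 2 - Re p ^+ 2 by rewrite sqr_normc2; ring.
    by rewrite mulrBl divff// expf_neq0// gt_eqF.
  by rewrite sqrtr_sqr ger0_norm// divr_ge0// ltW.
rewrite /carg; case: ifP => I0.
  by rewrite sin_acos// sE ger0_norm// mulrC divfK// gt_eqF.
by rewrite sinN sin_acos// sE ltr0_norm ?ltNge ?I0// mulNr opprK mulrC divfK// gt_eqF.
Qed.

Lemma Re_gt0_neq0 p : 0 < Re p -> p != 0.
Proof. by move=> p0; apply/eqP => p_0; rewrite p_0 /= ltxx in p0. Qed.

(** Along the logarithmic segment from [1] to [p] the real part stays away from
zero, because the cosine decreases on [0, pi]. *)
Lemma Re_cexp_segment p : 0 < Re p -> exists2 a : R, 0 < a &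
  forall s, 0 <= s <= 1 -> a <= Re (cexp (s%:C * clog p)).
Proof.
move=> p0; have pn0 := Re_gt0_neq0 p0.
have np0 : 0 < normc p by rewrite normc_gt0.
exists (expR (- `|ln (normc p)|) * (Re p / normc p)).
  by rewrite mulr_gt0 ?expR_gt0// divr_gt0.
move=> s /andP[s0 s1]; rewrite Re_cexp !cReImE /=.
rewrite -cos_carg//; apply: ler_pM.
- exact: expR_ge0.
- by rewrite cos_carg// ltW// divr_gt0.
- rewrite ler_expR lerNl; apply: le_trans (ler_norm _) _.
  by rewrite normrN normrM ger0_norm// ler_piMl.
have cn : forall u, 0 <= u <= pi -> cos u <= cos (s * u).
  move=> u /andP[u0 upi].
  have su : s * u <= u by rewrite ler_piMl.
  have : {in `[0, pi] &, {mono (@cos R) : x y /~ x <= y}}.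
    by apply: le_nmono_in => x y x_ y_ xy; rewrite ltr_cos.
  by move=> ->//; rewrite in_itv/= ?u0 ?upi// mulr_ge0//= (le_trans su).
have x1 := Re_div_normc_itv np0.
rewrite /carg; case: ifP => _; rewrite ?mulrN ?cosN;
  by apply: cn; rewrite acos_ge0// acos_lepi.
Qed.

(** Cutting [[0, 1]] into [N] pieces bounds the total increment by [C / N]. *)
Lemma quadratic_increments_cst (f : R -> R[i]) (C h0 : R) : 0 < h0 ->
  (forall s s', 0 <= s -> s <= s' -> s' <= 1 -> s' - s <= h0 ->
     normc (f s' - f s) <= C * (s' - s) ^+ 2) ->
  f 1 = f 0.
Proof.
move=> h00 fq; apply/eqP; rewrite -subr_eq0 -[_ == _]negbK -normc_gt0.
apply/negP => nu0; set nu := normc (f 1 - f 0) in nu0.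
pose N := (Num.truncn (h0^-1 + `|C| / nu)).+1.
have NR : h0^-1 + `|C| / nu < N%:R by exact: truncnS_gt.
have N0 : 0 < N%:R :> R by rewrite ltr0n.
have Nh : N%:R^-1 <= h0.
  rewrite -[leRHS]invrK lef_pV2 ?posrE ?invr_gt0//.
  by apply: le_trans (ltW NR); rewrite lerDl divr_ge0// ltW.
have step k : (k <= N)%N -> normc (f (k%:R / N%:R) - f 0) <= k%:R * (C / N%:R ^+ 2).
  elim: k => [|k IH] kN; first by rewrite !mul0r subrr normc0.
  have -> : f (k.+1%:R / N%:R) - f 0 =
    (f (k.+1%:R / N%:R) - f (k%:R / N%:R)) + (f (k%:R / N%:R) - f 0) by ring.
  have -> : k.+1%:R * (C / N%:R ^+ 2) = C / N%:R ^+ 2 + k%:R * (C / N%:R ^+ 2).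
    by rewrite -natr1; ring.
  apply: (le_trans (ler_normcD _ _)); apply: lerD; last by apply: IH; exact: ltnW.
  have E : k.+1%:R / N%:R - k%:R / N%:R = N%:R^-1 :> R by rewrite -natr1; ring.
  have -> : C / N%:R ^+ 2 = C * (k.+1%:R / N%:R - k%:R / N%:R) ^+ 2.
    by rewrite E exprVn.
  apply: fq; rewrite ?E//.
  - by rewrite ler_wpM2r ?invr_ge0 ?(ltW N0)// ler_nat.
  - by rewrite ler_pdivrMr// mul1r ler_nat.
have := step N (leqnn N); rewrite divff ?gt_eqF// -/nu.
have -> : N%:R * (C / N%:R ^+ 2) = C / N%:R by field; rewrite gt_eqF.
rewrite ler_pdivlMr//; apply/negP; rewrite -ltNge.
apply: (le_lt_trans (ler_norm _)); rewrite mulrC -ltr_pdivrMr//.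
by apply: le_lt_trans NR; rewrite lerDr invr_ge0 ltW.
Qed.

End Powers.

(** * Laplace transforms of powers *)

Section GammaIntegral.
Context {R : realType}.
Implicit Types (z w p P : R[i]) (t s : R).
Local Notation leb := (@lebesgue_measure R).
Local Notation D := (`]0, +oo[%classic : set (measurableTypeR R)).

Definition powexp w p t : R[i] := cpow t%:C (w - 1) * cexp (- (t%:C * p)).

Definition laplace_pow w p : R[i] := cintegral leb D (powexp w p).

Lemma in_halfline t : D t -> 0 < t. Proof. by rewrite /= in_itv/= andbT. Qed.

Lemma powexpE w p t : 0 < t ->
  powexp w p t = cexp ((w - 1) * (ln t)%:C - t%:C * p).
Proof. by move=> t0; rewrite /powexp cpow_real// -cexpD. Qed.

Lemma normc_powexp w p t : 0 < t -> normc (powexp w p t) = gdens (Re w) (Re p) t.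
Proof.
move=> t0; rewrite powexpE// normc_cexp /gdens; congr expR.
by rewrite !cReImE /=; ring.
Qed.

Lemma measurable_halfline : measurable D. Proof. exact: measurable_itv. Qed.
Let mD := measurable_halfline.

Lemma cmeasurable_powexp w p : cmeasurable D (powexp w p).
Proof.
apply: (@eq_cmeasurable _ _ _ _ (fun t : R => cexp ((w - 1) * (ln t)%:C - t%:C * p))).
  by move=> t /set_mem /in_halfline t0; rewrite powexpE.
apply: cmeasurable_cexp; apply: cmeasurableB; apply: cmeasurableM.
- exact: cmeasurable_cst.
- by apply: cmeasurable_real; apply: measurable_funTS; exact: measurable_ln.
- by apply: cmeasurable_real; exact: measurable_id.
- exact: cmeasurable_cst.
Qed.

Lemma cintegrable_powexp w p : 0 < Re w -> 0 < Re p ->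
  cintegrable leb D (powexp w p).
Proof.
move=> w0 p0; apply: (le_cintegrable mD (cmeasurable_powexp w p)
  (integrable_gdens w0 p0)) => t /in_halfline t0.
by rewrite normc_powexp.
Qed.

Lemma GammaE w : 0 < Re w -> Gamma w = laplace_pow w 1.
Proof.
move=> w0; rewrite /Gamma /Gamma_shift w0 big_ord0 divr1 addr0.
by apply: eq_cintegral => t _; rewrite /powexp mulr1.
Qed.

Lemma laplace_pow_scale w p s : 0 < s -> 0 < Re w -> 0 < Re p ->
  laplace_pow w p = cexp (w * (ln s)%:C) * laplace_pow w (s%:C * p).
Proof.
move=> s0 w0 p0.
have sp0 : 0 < Re (s%:C * p) by rewrite cReRM mulr_gt0.
have E t : 0 < t -> s%:C * powexp w p (s * t) =
    cexp (w * (ln s)%:C) * powexp w (s%:C * p) t.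
  move=> t0; have sE : s%:C = cexp (ln s)%:C by rewrite cexp_real lnK.
  rewrite !powexpE ?mulr_gt0// lnM ?posrE// {1}sE -!cexpD; congr cexp.
  by rewrite !rmorphD /= !rmorphM /=; ring.
have i1 : cintegrable leb D (fun t => powexp w p (s * t)).
  apply: (@eq_cintegrable _ _ _ _ _ mD (fun t =>
     s^-1%:C * (cexp (w * (ln s)%:C) * powexp w (s%:C * p) t))).
    move=> t /set_mem /in_halfline t0; rewrite -E// mulrA -rmorphM /=.
    by rewrite mulVf ?mul1r// gt_eqF.
  by apply: cintegrableZ => //; apply: cintegrableZ => //; exact: cintegrable_powexp.
rewrite /laplace_pow (cintegral_scale s0)//; last exact: cintegrable_powexp.
rewrite -cintegralZ// -[RHS]cintegralZ//; last exact: cintegrable_powexp.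
by apply: eq_cintegral => t /set_mem /in_halfline t0; exact: E.
Qed.

(** Second order estimate behind the differentiation of
[exp (w d) * t ^ (w - 1) * exp (- t P exp d)] in [d]: the weights in [t] are
absorbed by half of the exponential decay. *)
Lemma powexp_expansion w (a B : R) : 0 < a -> 0 <= B ->
  exists C e : R, [/\ 0 < e, 0 <= C &
   forall P z, a <= Re P -> normc P <= B -> normc z <= e ->
    a / 2 <= Re (P * cexp z) /\
    forall t, 0 < t ->
     normc (cexp (w * z) * powexp w (P * cexp z) t - powexp w P t
       - z * ((w - t%:C * P) * powexp w P t))
     <= C * normc z ^+ 2 * gdens (Re w) (a / 2) t].
Proof.
move=> a0 B0.
pose E1 : R := expR 1; have E11 : 1 <= E1 by rewrite /E1 -expR0 ler_expR.
(* [M t |z|] bounds the perturbation of the phase, and [e] is small enough for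
   [exp (2 e M t)] to cost at most half of the decay [exp (- a t)] *)
pose M := 4 * E1 * (B + 1).
have M0 : 0 < M by rewrite !mulr_gt0 ?expR_gt0//; lra.
pose e := Num.min 1 (a / (4 * M)).
have e0 : 0 < e by rewrite lt_min ltr01 divr_gt0// mulr_gt0.
have e1 : e <= 1 by rewrite ge_min lexx.
have eM : e * M <= a / 4.
  have : e <= a / (4 * M) by rewrite ge_min lexx orbT.
  by rewrite ler_pdivlMr ?mulr_gt0//; lra.
pose W := normc w; have W0 : 0 <= W := normc_ge0 w.
exists ((8 / e ^+ 2 + e^-1) * expR (2 * e * W)), e; split => //.
  by rewrite mulr_ge0 ?expR_ge0// addr_ge0 ?divr_ge0 ?invr_ge0 ?sqr_ge0// ltW.
move=> P z aP PB ze; set d := normc z in ze *; have d0 : 0 <= d := normc_ge0 z.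
have P0 := normc_ge0 P.
have ed : expR d <= E1 by rewrite ler_expR (le_trans ze).
have h1 : normc (cexp z - 1) <= 3 * E1 * d.
  apply: (le_trans (normc_cexp1B_le z)); rewrite -/d.
  by have := ler_wpM2l d0 ed; lra.
have h2 : normc (cexp z - 1 - z) <= 4 * E1 * d ^+ 2.
  apply: (le_trans (normc_cexp1DB_le z)); rewrite -/d.
  by have := ler_wpM2l (sqr_ge0 d) ed; lra.
have Pd : normc (P * (cexp z - 1)) <= M * d.
  rewrite normcM; apply: (le_trans (ler_pM P0 (normc_ge0 _) PB h1)).
  have : 0 <= E1 * d by rewrite mulr_ge0//; lra.
  move=> Ed; have : 0 <= E1 * d * B by rewrite mulr_ge0.
  by rewrite /M; lra.
split.
  have -> : P * cexp z = P + P * (cexp z - 1) by ring.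
  have h3 : M * d <= a / 4.
    by apply: le_trans eM; rewrite mulrC ler_wpM2r// ltW.
  have := le_trans (le_trans (Re_le_normc _) Pd) h3.
  by rewrite cReD ler_norml => /andP[+ _]; lra.
move=> t t0; set X := w * z - t%:C * (P * (cexp z - 1)).
have XE : cexp (w * z) * powexp w (P * cexp z) t = cexp X * powexp w P t.
  by rewrite !powexpE// -!cexpD; congr cexp; rewrite /X; ring.
have -> : cexp (w * z) * powexp w (P * cexp z) t - powexp w P t
       - z * ((w - t%:C * P) * powexp w P t) =
   (cexp X - 1 - z * (w - t%:C * P)) * powexp w P t by rewrite XE; ring.
rewrite normcM normc_powexp//.
pose Y := W + M * t; have Y0 : 0 <= Y by rewrite addr_ge0// mulr_ge0// ltW.
have tP : normc (t%:C * (P * (cexp z - 1))) <= M * t * d.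
  by rewrite normcM normc_real gtr0_norm//; have := ler_wpM2l (ltW t0) Pd; lra.
have XY : normc X <= d * Y.
  apply: (le_trans (ler_normcB _ _)); rewrite normcM -/W -/d /Y.
  by have := tP; lra.
have X2 : normc (X - z * (w - t%:C * P)) <= d ^+ 2 * Y.
  have -> : X - z * (w - t%:C * P) = - (t%:C * (P * (cexp z - 1 - z))).
    by rewrite /X; ring.
  rewrite normcN !normcM normc_real gtr0_norm//.
  have h3 : normc P * normc (cexp z - 1 - z) <= M * d ^+ 2.
    apply: (le_trans (ler_pM P0 (normc_ge0 _) PB h2)).
    have : 0 <= E1 * d ^+ 2 by rewrite mulr_ge0 ?sqr_ge0//; lra.
    by rewrite /M; lra.
  apply: (le_trans (ler_wpM2l (ltW t0) h3)).
  have : 0 <= d ^+ 2 * W by rewrite mulr_ge0 ?sqr_ge0.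
  by rewrite /Y; lra.
have eY0 : 0 <= e * Y by rewrite mulr_ge0// ltW.
set Q := expR (e * Y); have Q1 : 1 <= Q by rewrite -expR0 ler_expR.
have Q2 : expR (2 * e * Y) = Q ^+ 2.
  by rewrite /Q -expRM_natl; congr expR; ring.
have YQ : Y <= e^-1 * Q.
  rewrite mulrC ler_pdivlMr// mulrC.
  by apply: (le_trans _ (expR_ge1Dx (e * Y))); lra.
have Y2Q : Y ^+ 2 <= 2 / e ^+ 2 * Q.
  rewrite mulrAC ler_pdivlMr ?exprn_gt0// -exprMn [Y * e]mulrC.
  have := @expR_ge1Dxn R (e * Y) 1 eY0; rewrite -/Q.
  by have -> : 2`!%:R = 2 :> R by []; lra.
have g1 : normc (cexp X - 1 - X) <= d ^+ 2 * (8 / e ^+ 2 * Q ^+ 2).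
  apply: (le_trans (normc_cexp1DB_le X)).
  have g11 : normc X ^+ 2 <= d ^+ 2 * Y ^+ 2.
    by rewrite -exprMn lerXn2r ?nnegrE ?normc_ge0// mulr_ge0.
  have g12 : expR (normc X) <= Q.
    rewrite ler_expR; apply: (le_trans XY).
    by rewrite ler_wpM2r.
  have g13 : normc X ^+ 2 * expR (normc X) <= d ^+ 2 * Y ^+ 2 * Q.
    by rewrite ler_pM ?sqr_ge0 ?expR_ge0.
  have g14 : d ^+ 2 * Y ^+ 2 * Q <= d ^+ 2 * (2 / e ^+ 2 * Q) * Q.
    by rewrite ler_wpM2r ?(le_trans ler01 Q1)// ler_wpM2l ?sqr_ge0.
  by lra.
have g2 : normc (X - z * (w - t%:C * P)) <= d ^+ 2 * (e^-1 * Q ^+ 2).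
  apply: (le_trans X2); rewrite ler_wpM2l ?sqr_ge0//; apply: (le_trans YQ).
  by rewrite ler_wpM2l ?invr_ge0 ?(ltW e0)// expr2 ler_peMl// (le_trans ler01).
have g3 : normc (cexp X - 1 - z * (w - t%:C * P)) <=
    (8 / e ^+ 2 + e^-1) * d ^+ 2 * Q ^+ 2.
  have -> : cexp X - 1 - z * (w - t%:C * P) =
    (cexp X - 1 - X) + (X - z * (w - t%:C * P)) by ring.
  by apply: (le_trans (ler_normcD _ _)); lra.
have g4 : Q ^+ 2 * gdens (Re w) (Re P) t <=
    expR (2 * e * W) * gdens (Re w) (a / 2) t.
  rewrite -Q2 /gdens -!expRD ler_expR /Y.
  have := ler_wpM2r (ltW t0) aP; have := ler_wpM2r (ltW t0) eM.
  by lra.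
have k0 : 0 <= (8 / e ^+ 2 + e^-1) * d ^+ 2.
  by rewrite mulr_ge0 ?sqr_ge0// addr_ge0 ?divr_ge0 ?invr_ge0 ?sqr_ge0// ltW.
have := ler_wpM2r (ltW (gdens_gt0 (Re w) (Re P) t)) g3.
have := ler_wpM2l k0 g4.
by lra.
Qed.

End GammaIntegral.

(** * Values and lower bounds of the Gamma function *)

Section GammaValues.
Context {R : realType}.
Implicit Types (z w p P : R[i]) (t s : R).
Local Notation leb := (@lebesgue_measure R).
Local Notation D := (`]0, +oo[%classic : set (measurableTypeR R)).
Let mD := @measurable_halfline R.

Lemma powexpS w p t : 0 < t -> powexp (w + 1) p t = t%:C * powexp w p t.
Proof.
move=> t0; have tE : t%:C = cexp (ln t)%:C by rewrite cexp_real lnK.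
rewrite !powexpE// [X in _ = X * _]tE -cexpD; congr cexp.
by ring.
Qed.

(** The first order term of
[exp (w z) * laplace_pow w (P exp z)] at [z = 0] is the defect in the functional
equation. *)
Lemma laplace_pow_expansion w (a B : R) : 0 < Re w -> 0 < a -> 0 <= B ->
  exists C e : R, [/\ 0 < e, 0 <= C &
   forall P z, a <= Re P -> normc P <= B -> normc z <= e ->
     normc (cexp (w * z) * laplace_pow w (P * cexp z) - laplace_pow w P
       - z * (w * laplace_pow w P - P * laplace_pow (w + 1) P))
     <= C * normc z ^+ 2].
Proof.
move=> w0 a0 B0; have [C [e [e0 C0 H]]] := powexp_expansion w a0 B0.
have a20 : 0 < a / 2 by rewrite divr_gt0.
exists (2 * (C * Rintegral leb D (gdens (Re w) (a / 2)))), e; split=> //.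
  rewrite !mulr_ge0//; apply: Rintegral_ge0 => t _.
  by rewrite ltW// gdens_gt0.
move=> P z aP PB ze; have [rez Ht] := H P z aP PB ze.
have P0 : 0 < Re P := lt_le_trans a0 aP.
have Pz0 : 0 < Re (P * cexp z) := lt_le_trans a20 rez.
have w10 : 0 < Re (w + 1) by rewrite cReD /=; lra.
have i1 := cintegrable_powexp w0 Pz0; have i2 := cintegrable_powexp w0 P0.
have i3 := cintegrable_powexp w10 P0.
have Zi z' f : cintegrable leb D f -> cintegrable leb D (fun t => z' * f t).
  by move=> fi; exact: cintegrableZ.
have Bi f g : cintegrable leb D f -> cintegrable leb D g -> cintegrable leb D (fun t => f t - g t).
  by move=> fi gi; exact: cintegrableB.
rewrite /laplace_pow.
rewrite -!(cintegralZ mD _ i1) -!(cintegralZ mD _ i2) -!(cintegralZ mD _ i3).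
rewrite -(cintegralB mD (Zi _ _ i1) i2) -(cintegralB mD (Zi _ _ i2) (Zi _ _ i3)).
have j1 := Bi _ _ (Zi (cexp (w * z)) _ i1) i2.
have j2 := Bi _ _ (Zi w _ i2) (Zi P _ i3).
rewrite -(cintegralZ mD _ j2) -(cintegralB mD j1 (Zi _ _ j2)).
have ig : leb.-integrable D (EFin \o (fun t => C * normc z ^+ 2 * gdens (Re w) (a / 2) t)).
  apply: eq_integrable (integrableZl mD (C * normc z ^+ 2) (integrable_gdens w0 a20)) => //.
apply: (le_trans (normc_cintegral_le mD (Bi _ _ j1 (Zi z _ j2)) ig _)).
  move=> t /in_halfline t0; rewrite powexpS//.
  apply: le_trans (Ht t t0); rewrite le_eqVlt; apply/orP; left; apply/eqP.
  by congr normc; ring.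
rewrite RintegralZl//; last exact: integrable_gdens.
by rewrite le_eqVlt; apply/orP; left; apply/eqP; ring.
Qed.

(** Real dilations do not change [exp (w h) * laplace_pow w (P exp h)], so its
derivative at the origin vanishes. *)
Lemma laplace_powS w P : 0 < Re w -> 0 < Re P ->
  P * laplace_pow (w + 1) P = w * laplace_pow w P.
Proof.
move=> w0 P0; apply/eqP; rewrite eq_sym -subr_eq0 -[_ == _]negbK -normc_gt0.
apply/negP; set kap := w * _ - _ => k0.
have [C [e [e0 C0 H]]] := laplace_pow_expansion w0 P0 (normc_ge0 P).
(* for this real increment the linear term would exceed the quadratic error *)
pose h := Num.min e (normc kap / (C + 1)).
have h0 : 0 < h by rewrite lt_min e0 divr_gt0//; lra.
have he : h <= e by rewrite ge_min lexx.
have hk : h <= normc kap / (C + 1) by rewrite ge_min lexx orbT.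
have := H P h%:C (lexx _) (lexx _); rewrite normc_real gtr0_norm// => /(_ he).
rewrite cexp_real (_ : P * (expR h)%:C = (expR h)%:C * P); last exact: mulrC.
have -> : cexp (w * h%:C) * laplace_pow w ((expR h)%:C * P) = laplace_pow w P.
  by rewrite (@laplace_pow_scale _ w P (expR h))// ?expR_gt0// expRK.
rewrite subrr sub0r normcN normcM normc_real gtr0_norm// -/kap.
apply/negP; rewrite -ltNge expr2 mulrA mulrC ltr_pM2l//.
move: hk; rewrite ler_pdivlMr; last by lra.
by have := mulr_ge0 C0 (ltW h0); lra.
Qed.

(** The dilation invariance persists for complex dilations: along the
logarithmic segment from [1] to [p] the function has quadratically small
increments. *)
Lemma laplace_powE w p : 0 < Re w -> 0 < Re p ->
  laplace_pow w p = Gamma w / cpow p w.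
Proof.
move=> w0 p0; have pn0 := Re_gt0_neq0 p0.
rewrite GammaE// /cpow; set L := clog p.
pose f s := cexp (w * (s%:C * L)) * laplace_pow w (cexp (s%:C * L)).
suff f10 : f 1 = f 0.
  apply: (mulIf (cexp_neq0 (w * L))); rewrite mulfVK ?cexp_neq0//.
  move: f10; rewrite /f mul1r cexp_clog// mul0r mulr0 cexp0 mul1r => <-.
  exact: mulrC.
have [a a0 aP] := Re_cexp_segment p0.
pose B := expR `|Re L|.
have [C [e [e0 C0 H]]] := laplace_pow_expansion w0 a0 (expR_ge0 `|Re L| : 0 <= B).
have L0 := normc_ge0 L.
pose K := expR (normc w * normc L).
apply: (@quadratic_increments_cst _ f (K * C * normc L ^+ 2) (e / (normc L + 1))).
  by rewrite divr_gt0//; lra.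
move=> s s' s0 ss' s'1; rewrite ler_pdivlMr; last by lra.
move=> hL; set h := s' - s in hL *; have h0 : 0 <= h by rewrite subr_ge0.
pose P := cexp (s%:C * L).
have s01 : 0 <= s <= 1 by rewrite s0 (le_trans ss').
have PB : normc P <= B.
  rewrite normc_cexp ler_expR cReRM; apply: (le_trans (ler_norm _)).
  by rewrite normrM ger0_norm// ler_piMl//; case/andP: s01.
have hLe : normc (h%:C * L) <= e.
  by rewrite normcM normc_real ger0_norm//; lra.
have := H P (h%:C * L) (aP s s01) PB hLe.
rewrite laplace_powS//; last exact: lt_le_trans a0 (aP s s01).
rewrite subrr mulr0 subr0 => H1.
have s'E : s'%:C * L = s%:C * L + h%:C * L.
  by rewrite /h rmorphB /=; ring.
have -> : f s' - f s = cexp (w * (s%:C * L)) *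
   (cexp (w * (h%:C * L)) * laplace_pow w (P * cexp (h%:C * L)) - laplace_pow w P).
  by rewrite /f s'E mulrDr !cexpD -/P; ring.
rewrite normcM normc_cexp.
have K1 : expR (Re (w * (s%:C * L))) <= K.
  rewrite ler_expR; apply: (le_trans (ler_norm _)); apply: (le_trans (Re_le_normc _)).
  rewrite !normcM normc_real ger0_norm// ler_wpM2l ?normc_ge0// ler_piMl//.
  by case/andP: s01.
apply: (le_trans (ler_pM (expR_ge0 _) (normc_ge0 _) K1 H1)).
rewrite normcM normc_real ger0_norm// exprMn le_eqVlt; apply/orP; left; apply/eqP.
by ring.
Qed.

Lemma GammaS w : 0 < Re w -> Gamma (w + 1) = w * Gamma w.
Proof.
move=> w0; have w10 : 0 < Re (w + 1) by rewrite cReD /=; lra.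
by rewrite !GammaE// -laplace_powS// mul1r.
Qed.

(** The real Gamma function; [rgammaE] identifies it as a total mass. *)
Definition rgamma s : R := Re (Gamma s%:C).

Lemma gdensE s a t : 0 < t -> (gdens s a t)%:C = powexp s%:C a%:C t.
Proof.
move=> t0; rewrite powexpE// /gdens -cexp_real; congr cexp.
by rewrite rmorphB !rmorphM rmorphB /=; ring.
Qed.

Lemma Rintegral_gdens s a : 0 < s -> 0 < a ->
  Rintegral leb D (gdens s a) = rgamma s * expR (- (s * ln a)).
Proof.
move=> s0 a0.
have -> : Rintegral leb D (gdens s a) = Re (laplace_pow s%:C a%:C).
  by apply: eq_Rintegral => t /set_mem /in_halfline t0; rewrite -gdensE.
rewrite laplace_powE// cpow_real//.
have -> : (cexp (s%:C * (ln a)%:C))^-1 = (expR (- (s * ln a)))%:C.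
  by rewrite -cexpN -rmorphM -rmorphN cexp_real.
by rewrite mulrC cReRM mulrC.
Qed.

Lemma rgammaE s : 0 < s -> rgamma s = Rintegral leb D (gdens s 1).
Proof. by move=> s0; rewrite Rintegral_gdens// ln1 mulr0 oppr0 expR0 mulr1. Qed.

Lemma rgammaS s : 0 < s -> rgamma (s + 1) = s * rgamma s.
Proof.
by move=> s0; rewrite /rgamma rmorphD /= GammaS// cReRM.
Qed.

(** The density is bounded below on [[1, 2]]. *)
Lemma rgamma_gt0 s : 0 < s -> 0 < rgamma s.
Proof.
move=> s0; rewrite rgammaE//.
have i := integrable_gdens s0 (@ltr01 R).
pose c : R := expR (- `|s - 1| * ln 2 - 2).
pose I12 : set (measurableTypeR R) := `[1, 2]%classic.
have m12 : measurable I12 by exact: measurable_itv.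
have s12 : I12 `<=` D.
  by move=> t; rewrite /I12 /= !in_itv/= andbT => /andP[+ _]; exact: lt_le_trans.
apply: (@lt_le_trans _ _ c); first exact: expR_gt0.
rewrite -lee_fin /Rintegral fineK; last exact: integrable_fin_num.
apply: (@le_trans _ _ (\int[leb]_(t in I12) c%:E)%E).
  rewrite integral_cst//= /I12 lebesgue_measure_itv/= lte_fin ltr1n -EFinB.
  by rewrite -EFinM lee_fin (_ : 2 - 1 = 1) ?mulr1//; ring.
apply: (@le_trans _ _ (\int[leb]_(t in I12) (gdens s 1 t)%:E)%E).
  apply: ge0_le_integral => //.
  - by move=> t _; rewrite lee_fin expR_ge0.
  - by apply/measurable_EFinP; exact: measurable_gdens.
  - move=> t; rewrite /I12 /= in_itv/= => /andP[t1 t2].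
    rewrite lee_fin /gdens ler_expR mul1r; apply: lerB => //.
    have lt0 : 0 <= ln t by rewrite ln_ge0.
    have lt2 : ln t <= ln 2 by rewrite ler_ln ?posrE// (lt_le_trans ltr01).
    have h1 : `|s - 1| * ln t <= `|s - 1| * ln 2 by rewrite ler_wpM2l.
    have h2 : - `|s - 1| * ln t <= (s - 1) * ln t.
      by rewrite ler_wpM2r// lerNl -normrN ler_norm.
    by lra.
apply: ge0_subset_integral => //.
- by apply/measurable_EFinP; exact: measurable_gdens.
- by move=> t _; rewrite lee_fin ltW// gdens_gt0.
Qed.

(** Combines [1 - cos (x v) <= (x v) ^ 2 / 2] with
[v ^ 2 <= 4 (exp v + exp (- v) - 2)].  For [v = log (t / s)] the last bracket is
[t / s + s / t - 2], which the Gamma density integrates explicitly. *)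
Lemma cos_ge_expR (x v : R) :
  1 - 2 * x ^+ 2 * (expR v + expR (- v) - 2) <= cos (x * v).
Proof.
apply: le_trans (cos_ge1Bsqr (x * v)).
suff : v ^+ 2 <= 4 * (expR v + expR (- v) - 2).
  move=> h; have := ler_wpM2l (sqr_ge0 x) h; rewrite exprMn; lra.
wlog v0 : v / 0 <= v.
  move=> H; have [/H//|/ltW v0] := leP 0 v.
  by have := H (- v); rewrite oppr_ge0 sqrrN opprK => /(_ v0); lra.
set A := expR (v / 2); set B := expR (- (v / 2)).
have AB : A * B = 1 by rewrite -expRD subrr expR0.
have -> : expR v + expR (- v) - 2 = (A - B) ^+ 2.
  have -> : expR v = A ^+ 2 by rewrite -expRM_natl; congr expR; lra.
  have -> : expR (- v) = B ^+ 2 by rewrite -expRM_natl; congr expR; lra.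
  by rewrite sqrrB AB; ring.
have A1 : 1 + v / 2 <= A := expR_ge1Dx _.
have B1 : B <= 1 by rewrite -expR0 ler_expR; lra.
have : (v / 2) ^+ 2 <= (A - B) ^+ 2 by rewrite lerXn2r ?nnegrE//; lra.
by rewrite expr_div_n; lra.
Qed.

(** Up to the unimodular factor [u = s ^ (- i x)], the quotient of
[Gamma (s + i x)] by [Gamma s] is the mean of [exp (i x log (t / s))] for the
Gamma distribution, and the phase [log (t / s)] has second moment [O (1 / s)]. *)
Lemma Gamma_ge (s x : R) : 1 < s ->
  (1 - 2 * x ^+ 2 / (s - 1)) * rgamma s <= normc (Gamma (s +i* x)).
Proof.
move=> s1; have s0 : 0 < s by lra.
have s10 : 0 < s - 1 by lra.
set w : R[i] := s +i* x; have w0 : 0 < Re w by [].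
(* [u] recentres the phase at [log s] *)
pose u : R[i] := cexp (0 +i* (- (x * ln s))).
have nu : normc u = 1 by rewrite normc_cexp /= expR0.
have -> : normc (Gamma w) = normc (u * Gamma w) by rewrite (normcM u) nu mul1r.
apply: le_trans (Re_le_normc _); apply: le_trans (ler_norm _).
rewrite GammaE// /laplace_pow -cintegralZ//; last exact: cintegrable_powexp.
pose k : R := 2 * x ^+ 2.
(* [g t = gdens s 1 t * (1 - k (t / s + s / t - 2))] *)
pose g t : R := (1 + 2 * k) * gdens s 1 t + (- (k / s)) * gdens (s + 1) 1 t
   + (- (k * s)) * gdens (s - 1) 1 t.
have Di c r : 0 < r -> leb.-integrable D (EFin \o (fun t => c * gdens r 1 t)).
  by move=> r0; apply: eq_integrable (integrableZl mD c (integrable_gdens r0 (@ltr01 R))) => //.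
have s20 : 0 < s + 1 by lra.
have Di2 : leb.-integrable D (EFin \o (fun t => (1 + 2 * k) * gdens s 1 t + (- (k / s)) * gdens (s + 1) 1 t)).
  by apply: eq_integrable (integrableD mD (Di _ _ s0) (Di _ _ s20)).
have ig : leb.-integrable D (EFin \o g).
  by apply: eq_integrable (integrableD mD Di2 (Di _ _ s10)).
have gI : Rintegral leb D g = (1 - k / (s - 1)) * rgamma s.
  rewrite /g RintegralD//; last exact: Di.
  rewrite RintegralD//; [|exact: Di..].
  rewrite !RintegralZl//; [|exact: integrable_gdens..].
  rewrite -!rgammaE// rgammaS// -[in RHS](subrK 1 s) -[in LHS](subrK 1 s).
  rewrite rgammaS//; set G := rgamma _.
  have -> : s - 1 + 1 = s by ring.
  by field; rewrite !gt_eqF.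
rewrite -/k -gI; apply: le_Rintegral => //.
  by have [] := cintegrableZ mD u (cintegrable_powexp w0 (@ltr01 R : 0 < Re (1 : R[i]))).
move=> t /in_halfline t0; rewrite powexpE// /u -cexpD Re_cexp.
pose v := ln t - ln s.
have -> : Re (0 +i* (- (x * ln s)) + ((w - 1) * (ln t)%:C - t%:C * 1)) =
   (s - 1) * ln t - 1 * t by rewrite !cReImE /=; ring.
have -> : Im (0 +i* (- (x * ln s)) + ((w - 1) * (ln t)%:C - t%:C * 1)) = x * v.
  by rewrite !cReImE /= /v; ring.
rewrite -/(gdens s 1 t).
apply: le_trans (ler_wpM2l (ltW (gdens_gt0 _ _ _)) (cos_ge_expR x v)).
have -> : expR v = t / s by rewrite /v expRB !lnK.
have -> : expR (- v) = s / t by rewrite /v opprB expRB !lnK.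
have gS r : gdens (r + 1) 1 t = t * gdens r 1 t.
  have tE : t = expR (ln t) by rewrite lnK.
  by rewrite /gdens [X in _ = X * _]tE -expRD; congr expR; ring.
rewrite /g gS.
have -> : gdens (s - 1) 1 t = gdens s 1 t / t.
  by rewrite -[in RHS](subrK 1 s) gS mulrC mulKf// gt_eqF.
rewrite -/k le_eqVlt; apply/orP; left; apply/eqP.
by field; rewrite !gt_eqF.
Qed.

End GammaValues.

Section GammaComparison.
Context {R : realType}.
Implicit Types (w : R[i]).

Lemma rgamma_le2Gamma w : 1 + 4 * Im w ^+ 2 < Re w ->
  rgamma (Re w) <= 2 * normc (Gamma w).
Proof.
case: w => s x /= h; have x2 := sqr_ge0 x.
have s1 : 1 < s by lra.
have hG := Gamma_ge x s1.
have h1 : 2 * x ^+ 2 / (s - 1) <= 2^-1 by rewrite ler_pdivrMr; lra.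
have h2 : 2^-1 * rgamma s <= (1 - 2 * x ^+ 2 / (s - 1)) * rgamma s.
  have s0 : 0 < s by lra.
  by apply: ler_wpM2r; [rewrite ltW// rgamma_gt0|lra].
by lra.
Qed.

(** A zero would propagate to [w + n] for all [n], against the lower bound. *)
Lemma Gamma_neq0 w : 0 < Re w -> Gamma w != 0.
Proof.
move=> w0; apply/eqP => Gw.
have G n : Gamma (w + n%:R) = 0.
  elim: n => [|n IH]; first by rewrite addr0.
  rewrite -natr1 addrA GammaS ?IH ?mulr0// cReD.
  have -> : Re (n%:R : R[i]) = n%:R by rewrite -(rmorph_nat (real_complex R)).
  by rewrite ltr_wpDr.
pose n := (Num.truncn (1 + 4 * Im w ^+ 2)).+1.
have nn : 1 + 4 * Im w ^+ 2 < n%:R by exact: truncnS_gt.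
have Rn : Re (w + n%:R) = Re w + n%:R.
  by rewrite cReD -(rmorph_nat (real_complex R)).
have In : Im (w + n%:R) = Im w.
  by rewrite cImD -(rmorph_nat (real_complex R)) /= addr0.
have := @rgamma_le2Gamma (w + n%:R); rewrite In Rn G normc0 mulr0.
have I2 := sqr_ge0 (Im w).
have p : 0 < rgamma (Re w + n%:R) by apply: rgamma_gt0; lra.
move=> h; have {}h : rgamma (Re w + n%:R) <= 0 by apply: h; lra.
by lra.
Qed.

(** The factor [2] works once the real part is large; the finitely many other
terms are compared one by one, Gamma being nonzero. *)
Lemma rgamma_le_Gamma w (mu : R) : 0 < Re w -> 0 < mu ->
  exists2 C : R, 0 <= C & forall m : nat,
    rgamma (Re w + mu * m%:R) <= C * normc (Gamma (w + (mu * m%:R)%:C)).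
Proof.
move=> w0 mu0; pose s (m : nat) := Re w + mu * m%:R.
have s0 m : 0 < s m by rewrite ltr_wpDr// mulr_ge0// ltW.
have Rs m : Re (w + (mu * m%:R)%:C) = s m by rewrite cReD.
have Is m : Im (w + (mu * m%:R)%:C) = Im w by rewrite cImD /= addr0.
have G0 m : 0 < normc (Gamma (w + (mu * m%:R)%:C)).
  by rewrite normc_gt0 Gamma_neq0// Rs.
pose q m := rgamma (s m) / normc (Gamma (w + (mu * m%:R)%:C)).
have q0 m : 0 <= q m by rewrite divr_ge0// ltW// rgamma_gt0.
pose M := (Num.truncn ((1 + 4 * Im w ^+ 2) / mu)).+1.
have S0 : 0 <= \sum_(m < M) q m by apply: sumr_ge0.
exists (2 + \sum_(m < M) q m); first by lra.
move=> m; have [mM|Mm] := ltnP m M.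
  rewrite -ler_pdivrMr// -/(q m).
  rewrite (bigD1 (Ordinal mM))//= addrCA lerDl addr_ge0//.
  by apply: sumr_ge0.
have h : 1 + 4 * Im w ^+ 2 < s m.
  have h1 : (1 + 4 * Im w ^+ 2) / mu < M%:R by exact: truncnS_gt.
  have h2 : M%:R <= m%:R :> R by rewrite ler_nat.
  have := lt_le_trans h1 h2; rewrite ltr_pdivrMr// /s.
  by lra.
have := @rgamma_le2Gamma (w + (mu * m%:R)%:C); rewrite Rs Is => /(_ h) h2.
apply: (le_trans h2); rewrite ler_wpM2r ?normc_ge0//; lra.
Qed.

End GammaComparison.

(** * Analytic continuation of Laplace transforms along a ray *)

Section Continuation.
Context {R : realType} {d : measure_display} {T : measurableType d}.
Variable mu : {measure set T -> \bar R}.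
Variable D : set T.
Hypothesis mD : measurable D.
Variables (Psi1 Psi2 z1 z2 : T -> R[i]) (c : R).
Hypotheses (c0 : 0 < c) (c1 : c <= 1).
Hypotheses (iPsi1 : cintegrable mu D Psi1) (iPsi2 : cintegrable mu D Psi2).
Hypotheses (mz1 : cmeasurable D z1) (mz2 : cmeasurable D z2).
Hypothesis sec1 : forall t, D t -> c * normc (z1 t) <= Re (z1 t).
Hypothesis sec2 : forall t, D t -> c * normc (z2 t) <= Re (z2 t).
Implicit Types (g : R[i] -> R[i]) (u eta M : R).

Let sector : set R[i] := [set z | c * normc z <= Re z].

(** Test functions: bounded on the sector that contains the phases, and
preserving measurability. *)
Let bounded_on_sector g M := (forall z, sector z -> normc (g z) <= M) /\
  (forall h : T -> R[i], cmeasurable D h -> cmeasurable D (fun t => g (h t))).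

(** The functional whose vanishing on the constant [1] is the goal. *)
Let Lam g := cintegral mu D (fun t => Psi1 t * g (z1 t)) -
  cintegral mu D (fun t => Psi2 t * g (z2 t)).

Let integrable_test g M (Psi h : T -> R[i]) : cintegrable mu D Psi ->
  cmeasurable D h -> (forall t, D t -> sector (h t)) -> bounded_on_sector g M ->
  cintegrable mu D (fun t => Psi t * g (h t)).
Proof.
move=> iPsi mh hs [gM mg].
apply: (@le_cintegrable _ _ _ mu D mD _ (fun t => M * normc (Psi t))).
- apply: cmeasurableM; first exact: cintegrable_measurable iPsi.
  exact: mg.
- exact: eq_integrable (integrableZl mD M (integrable_normc mD iPsi)).
- move=> t Dt; rewrite normcM mulrC ler_wpM2r ?normc_ge0//.
  by apply: gM; exact: hs.
Qed.

Let Lam_lin g g' M M' (a b : R[i]) :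
  bounded_on_sector g M -> bounded_on_sector g' M' ->
  Lam (fun z => a * g z + b * g' z) = a * Lam g + b * Lam g'.
Proof.
move=> hg hg'; rewrite /Lam.
have i1 := integrable_test iPsi1 mz1 sec1 hg.
have i2 := integrable_test iPsi2 mz2 sec2 hg.
have j1 := integrable_test iPsi1 mz1 sec1 hg'.
have j2 := integrable_test iPsi2 mz2 sec2 hg'.
have E (Psi h : T -> R[i]) : cintegrable mu D (fun t => Psi t * g (h t)) ->
    cintegrable mu D (fun t => Psi t * g' (h t)) ->
    cintegral mu D (fun t => Psi t * (a * g (h t) + b * g' (h t))) =
    a * cintegral mu D (fun t => Psi t * g (h t)) +
    b * cintegral mu D (fun t => Psi t * g' (h t)).
  move=> ig ig'; rewrite -!cintegralZ// -cintegralD//; [|exact: cintegrableZ..].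
  by apply: eq_cintegral => t _; ring.
by rewrite !E//; ring.
Qed.

(** Dominated convergence; [e_] is a null sequence common to all points. *)
Let Lam_lim (g_ : nat -> R[i] -> R[i]) g M (e_ : nat -> R) :
  (forall n, bounded_on_sector (g_ n) M) -> e_ @ \oo --> (0 : R) ->
  (forall z, sector z -> exists B : R, forall n, normc (g_ n z - g z) <= B * e_ n) ->
  (forall n, Lam (g_ n) = 0) -> Lam g = 0.
Proof.
move=> bg e0 ge L0.
have cv (Psi h : T -> R[i]) : cintegrable mu D Psi -> cmeasurable D h ->
   (forall t, D t -> sector (h t)) ->
   Re (cintegral mu D (fun t => Psi t * g_ n (h t))) @[n --> \oo] -->
     Re (cintegral mu D (fun t => Psi t * g (h t))) /\
   Im (cintegral mu D (fun t => Psi t * g_ n (h t))) @[n --> \oo] -->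
     Im (cintegral mu D (fun t => Psi t * g (h t))).
  move=> iPsi mh hs.
  have ptw t : D t ->
      (fun n => Re (Psi t * g_ n (h t))) @ \oo --> Re (Psi t * g (h t)) /\
      (fun n => Im (Psi t * g_ n (h t))) @ \oo --> Im (Psi t * g (h t)).
    move=> Dt; have [B HB] := ge _ (hs t Dt).
    have b0 : (fun n => normc (Psi t) * B * e_ n) @ \oo --> (0 : R).
      by rewrite -(mulr0 (normc (Psi t) * B)); apply: cvgM => //; exact: cvg_cst.
    have nb n : normc (Psi t * g_ n (h t) - Psi t * g (h t)) <= normc (Psi t) * B * e_ n.
      by rewrite -mulrBr normcM -mulrA ler_wpM2l ?normc_ge0.
    split; apply/subr_cvg0; apply: norm_cvg0;
      apply: squeeze_cvgr (@cvg_cst _ (0 : R) _ _ _) b0;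
      apply: nearW => n; rewrite /= normr_ge0 /= (le_trans _ (nb n))//.
    - by rewrite -cReB Re_le_normc.
    - by rewrite -cImB Im_le_normc.
  have [] := @cdominated_cvg _ _ _ mu D mD (fun n t => Psi t * g_ n (h t))
    (fun t => Psi t * g (h t)) (fun t => M * normc (Psi t)) _ _ _
    (fun t Dt => (ptw t Dt).1) (fun t Dt => (ptw t Dt).2).
  - by move=> n; have /cintegrable_measurable := integrable_test iPsi mh hs (bg n).
  - exact: eq_integrable (integrableZl mD M (integrable_normc mD iPsi)).
  - move=> n t Dt; rewrite normcM mulrC ler_wpM2r ?normc_ge0//.
    by apply: (bg n).1; exact: hs.
  by [].
have [a1 a2] := cv _ _ iPsi1 mz1 sec1; have [b1 b2] := cv _ _ iPsi2 mz2 sec2.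
have E n : cintegral mu D (fun t => Psi1 t * g_ n (z1 t)) =
    cintegral mu D (fun t => Psi2 t * g_ n (z2 t)).
  by apply/eqP; rewrite -subr_eq0; apply/eqP; exact: L0.
apply/eqP; rewrite subr_eq0; apply/eqP; apply: eqcP.
- by move: a1; under eq_cvg do rewrite E; move=> h; exact: cvg_unique h b1.
- by move: a2; under eq_cvg do rewrite E; move=> h; exact: cvg_unique h b2.
Qed.

(** [test 0 0 0 u] is [exp (- u z)]; in general a linear combination of the
exponentials of rates [u + j delta] for [j <= K]. *)
Let test eta (delta : R) (K : nat) u z : R[i] :=
  (1 + eta%:C * (1 - cexp (- (delta%:C * z)))) ^+ K * cexp (- (u%:C * z)).

Let test_measurable eta delta K u (h : T -> R[i]) :
  cmeasurable D h -> cmeasurable D (fun t => test eta delta K u (h t)).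
Proof.
move=> mh; apply: cmeasurableM.
  apply: cmeasurableX; apply: cmeasurableD; first exact: cmeasurable_cst.
  apply: cmeasurableM; first exact: cmeasurable_cst.
  apply: cmeasurableB; first exact: cmeasurable_cst.
  apply: cmeasurable_cexp; apply: cmeasurableN.
  exact: (cmeasurableM (cmeasurable_cst _ _) mh).
apply: cmeasurable_cexp; apply: cmeasurableN.
exact: (cmeasurableM (cmeasurable_cst _ _) mh).
Qed.

Let sector_Re z : sector z -> 0 <= Re z.
Proof. by apply: le_trans; rewrite mulr_ge0 ?normc_ge0// ltW. Qed.

Let factor_le eta delta z : 0 <= eta -> 0 <= delta -> sector z ->
  normc (1 + eta%:C * (1 - cexp (- (delta%:C * z)))) <= expR (3 * eta * delta * normc z).
Proof.
move=> eta0 delta0 zs; apply: le_trans (expR_ge1Dx _).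
apply: (le_trans (ler_normcD _ _)); rewrite normc1 lerD2l normcM normc_real ger0_norm//.
have Rz : 0 <= Re (delta%:C * z) by rewrite cReRM mulr_ge0 ?sector_Re.
have := ler_wpM2l eta0 (normc_1Bcexp_le Rz); rewrite normcM normc_real ger0_norm//.
by lra.
Qed.

Let test_bounded eta delta K u : 0 <= eta -> 0 <= delta -> 0 <= u ->
  3 * eta * delta * K%:R <= c * u -> bounded_on_sector (test eta delta K u) 1.
Proof.
move=> eta0 delta0 u0 h; split; last exact: test_measurable.
move=> z zs; rewrite /test normcM normcX normc_cexp cReN cReRM.
have f := factor_le eta0 delta0 zs.
apply: (@le_trans _ _ (expR (3 * eta * delta * normc z) ^+ K * expR (- (u * Re z)))).
  by rewrite ler_wpM2r ?expR_ge0// lerXn2r ?nnegrE ?normc_ge0 ?expR_ge0.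
rewrite -expRM_natl -expRD -[leRHS]expR0 ler_expR.
have := ler_wpM2r (normc_ge0 z) h; have := ler_wpM2l u0 zs.
by lra.
Qed.

Let test_bounded_weak eta delta K u : 0 <= eta -> 0 <= delta -> 0 <= u ->
  bounded_on_sector (test eta delta K u) ((1 + 2 * eta) ^+ K).
Proof.
move=> eta0 delta0 u0; split; last exact: test_measurable.
move=> z zs; rewrite /test normcM normcX normc_cexp cReN cReRM.
rewrite -[leRHS]mulr1; apply: ler_pM; rewrite ?exprn_ge0 ?normc_ge0 ?expR_ge0//; last first.
  by rewrite -expR0 ler_expR oppr_le0 mulr_ge0 ?sector_Re.
rewrite lerXn2r ?nnegrE ?normc_ge0//; first by lra.
apply: (le_trans (ler_normcD _ _)); rewrite normc1 lerD2l normcM normc_real ger0_norm//.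
rewrite mulrC ler_wpM2r//; apply: (le_trans (ler_normcB _ _)); rewrite normc1.
rewrite -[leRHS]/(1 + 1) lerD2l normc_cexp -expR0 ler_expR cReN oppr_le0 cReRM.
by rewrite mulr_ge0 ?sector_Re.
Qed.

Let Lam_test u0 eta delta K u : 0 <= u0 -> 0 <= eta -> 0 <= delta ->
  (forall u, u0 <= u -> Lam (test 0 0 0 u) = 0) -> u0 <= u ->
  Lam (test eta delta K u) = 0.
Proof.
move=> u00 eta0 delta0 H; elim: K u => [|K IH] u uu.
  by rewrite -(H u uu); congr Lam; apply/funext => z; rewrite /test !expr0.
have ud : u0 <= u + delta by lra.
have -> : test eta delta K.+1 u = (fun z => (1 + eta%:C) * test eta delta K u z +
    (- eta%:C) * test eta delta K (u + delta) z).
  apply/funext => z; rewrite /test exprS.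
  have -> : cexp (- ((u + delta)%:C * z)) = cexp (- (delta%:C * z)) * cexp (- (u%:C * z)).
    by rewrite -cexpD; congr cexp; rewrite rmorphD /=; ring.
  by ring.
rewrite (Lam_lin _ _ (test_bounded_weak K eta0 delta0 (le_trans u00 uu))
  (test_bounded_weak K eta0 delta0 (le_trans u00 ud))) !IH//.
by rewrite !mulr0 addr0.
Qed.

Let cvg_harm : (fun n : nat => n.+1%:R^-1 : R) @ \oo --> (0 : R).
Proof. exact: cvg_harmonic. Qed.

(** [exp (eta z)] is the limit of [(1 + eta (1 - exp (- z / K))) ^ K], which
only involves decaying exponentials. *)
Let test_cvg eta u z : 0 <= eta -> sector z -> exists B : R, forall n : nat,
  normc (test eta n.+1%:R^-1 n.+1 u z - test 0 0 0 (u - eta) z) <= B * n.+1%:R^-1.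
Proof.
move=> eta0 zs; pose r := normc z; have r0 : 0 <= r := normc_ge0 z.
pose q := expR (3 * eta * r).
pose B0 := 4 * (eta ^+ 2 + eta) * r ^+ 2 * expR ((eta + 1) * r).
exists (B0 * q * expR (- (u * Re z))) => n; set k : R := n.+1%:R^-1.
have k0 : 0 <= k by rewrite invr_ge0.
have k1 : k <= 1 by rewrite invf_le1 ?ltr0n// ler1n.
have nk : n.+1%:R * k = 1 by rewrite mulfV.
pose A := cexp ((eta * k)%:C * z); pose Bf := 1 + eta%:C * (1 - cexp (- (k%:C * z))).
have -> : test eta k n.+1 u z - test 0 0 0 (u - eta) z =
   (Bf ^+ n.+1 - A ^+ n.+1) * cexp (- (u%:C * z)).
  rewrite /test expr0 mul1r -/Bf mulrBl; congr (_ - _).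
  rewrite /A -cexpMn -cexpD; congr cexp.
  have -> : n.+1%:R * ((eta * k)%:C * z) = (eta * (n.+1%:R * k))%:C * z.
    by rewrite !rmorphM /= (rmorph_nat (real_complex R)); ring.
  by rewrite nk mulr1 rmorphB /=; ring.
rewrite normcM normc_cexp cReN cReRM.
have -> : B0 * q * expR (- (u * Re z)) * k = B0 * k * q * expR (- (u * Re z)) by ring.
rewrite ler_wpM2r ?expR_ge0//.
pose b := expR (3 * eta * k * r).
have Ab : normc A <= b.
  rewrite normc_cexp ler_expR cReRM.
  have h1 : Re z <= r := le_trans (ler_norm _) (Re_le_normc z).
  have ek : 0 <= eta * k by rewrite mulr_ge0.
  have := ler_wpM2l ek h1; have : 0 <= eta * k * r by rewrite mulr_ge0.
  by lra.
have Bb : normc Bf <= b by exact: factor_le.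
apply: (le_trans (normcXB n.+1 Bb Ab)).
have bq : b ^+ n.+1.-1 <= q.
  apply: (@le_trans _ _ (b ^+ n.+1)).
    rewrite ler_weXn2l//= -expR0 ler_expR; by rewrite !mulr_ge0.
  rewrite -expRM_natl ler_expR.
  have -> : n.+1%:R * (3 * eta * k * r) = 3 * eta * r * (n.+1%:R * k) by ring.
  by rewrite nk mulr1.
have BA : normc (Bf - A) <= B0 * k ^+ 2.
  have -> : Bf - A = - ((cexp ((eta * k)%:C * z) - 1 - (eta * k)%:C * z) +
     eta%:C * (cexp (- (k%:C * z)) - 1 - (- (k%:C * z)))).
    by rewrite /Bf /A rmorphM /=; ring.
  rewrite normcN; apply: (le_trans (ler_normcD _ _)).
  rewrite normcM normc_real ger0_norm//.
  have e1 : normc ((eta * k)%:C * z) = eta * k * r.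
    by rewrite normcM normc_real ger0_norm// mulr_ge0.
  have e2 : normc (- (k%:C * z)) = k * r.
    by rewrite normcN normcM normc_real ger0_norm.
  have E1 : expR (eta * k * r) <= expR ((eta + 1) * r).
    rewrite ler_expR.
    have : eta * r * k <= eta * r * 1 by rewrite ler_wpM2l// mulr_ge0.
    by lra.
  have E2 : expR (k * r) <= expR ((eta + 1) * r).
    rewrite ler_expR.
    have : r * k <= r * 1 by rewrite ler_wpM2l.
    have : 0 <= eta * r by rewrite mulr_ge0.
    by lra.
  have := normc_cexp1DB_le ((eta * k)%:C * z); rewrite e1 => p1.
  have := normc_cexp1DB_le (- (k%:C * z)); rewrite e2 => p2.
  have c1' : 0 <= 4 * (eta * k * r) ^+ 2 by rewrite mulr_ge0 ?sqr_ge0.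
  have c2' : 0 <= 4 * (k * r) ^+ 2 by rewrite mulr_ge0 ?sqr_ge0.
  have q1 := le_trans p1 (ler_wpM2l c1' E1).
  have q2 := ler_wpM2l eta0 (le_trans p2 (ler_wpM2l c2' E2)).
  by apply: (le_trans (lerD q1 q2)); rewrite /B0 le_eqVlt; apply/orP; left;
    apply/eqP; ring.
have B00 : 0 <= B0.
  by rewrite !mulr_ge0 ?expR_ge0 ?sqr_ge0// addr_ge0// sqr_ge0.
rewrite ler_pM ?mulr_ge0 ?exprn_ge0 ?expR_ge0 ?normc_ge0//.
have -> : B0 * k = n.+1%:R * (B0 * k ^+ 2).
  have -> : n.+1%:R * (B0 * k ^+ 2) = B0 * k * (n.+1%:R * k) by ring.
  by rewrite nk mulr1.
by rewrite ler_wpM2l.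
Qed.

(** The growth [exp (3 eta |z|)] of the approximations of [exp (eta z)] is
compensated by [exp (- u z)] on the sector as long as [3 eta <= c u], so rates
can be lowered by the factor [1 - c / 3]. *)
Let Lam_step u0 : 0 < u0 -> (forall u, u0 <= u -> Lam (test 0 0 0 u) = 0) ->
  forall u, (1 - c / 3) * u0 <= u -> Lam (test 0 0 0 u) = 0.
Proof.
move=> u00 H u hu; have c3 : c / 3 <= 1 / 3 by rewrite ler_pM2r.
have r0 : 0 < 1 - c / 3 by lra.
pose v := u / (1 - c / 3).
have uv : u = (1 - c / 3) * v by rewrite /v mulrC divfK// gt_eqF.
have vu0 : u0 <= v by rewrite /v ler_pdivlMr// mulrC.
pose eta := c / 3 * v; have v0 : 0 <= v by lra.
have eta0 : 0 <= eta by rewrite mulr_ge0// divr_ge0// ltW.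
have ueta : u = v - eta by rewrite uv /eta; ring.
rewrite ueta.
apply: (@Lam_lim (fun n => test eta n.+1%:R^-1 n.+1 v) _ 1 (fun n => n.+1%:R^-1)).
- move=> n; apply: test_bounded => //.
  by rewrite mulfVK// /eta; lra.
- exact: cvg_harm.
- by move=> z zs; exact: test_cvg.
- move=> n; have d0 : 0 <= n.+1%:R^-1 :> R by [].
  exact: (Lam_test n.+1 (ltW u00) eta0 d0 H vu0).
Qed.

(** The exponentials of rate at least [r ^ n * U] for [r = 1 - c / 3] are reached
after [n] steps, and they tend boundedly to [1]; this takes the place of the
identity theorem for analytic functions of the rate. *)
Lemma laplace_continuation (U : R) :
  (forall u, U <= u ->
    cintegral mu D (fun t => Psi1 t * cexp (- (u%:C * z1 t))) =
    cintegral mu D (fun t => Psi2 t * cexp (- (u%:C * z2 t)))) ->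
  cintegral mu D Psi1 = cintegral mu D Psi2.
Proof.
move=> H; pose U0 := Num.max U 1.
have U00 : 0 < U0 by rewrite lt_max ltr01 orbT.
have H0 u : U0 <= u -> Lam (test 0 0 0 u) = 0.
  rewrite ge_max => /andP[Uu _]; apply/eqP; rewrite subr_eq0; apply/eqP.
  have := H u Uu; congr (_ = _); apply: eq_cintegral => t _;
    by rewrite /test expr0 mul1r.
have c3 : c / 3 <= 1 / 3 by rewrite ler_pM2r.
have c30 : 0 < c / 3 by rewrite divr_gt0.
pose r := 1 - c / 3; have r0 : 0 < r by rewrite /r; lra.
have r1 : r < 1 by rewrite /r; lra.
have Hn n u : r ^+ n * U0 <= u -> Lam (test 0 0 0 u) = 0.
  elim: n u => [|n IH] u; first by rewrite mul1r; exact: H0.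
  rewrite exprS -mulrA; apply: Lam_step => //.
  by rewrite mulr_gt0// exprn_gt0.
have rn0 n : 0 <= r ^+ n * U0 by rewrite mulr_ge0 ?exprn_ge0 ?ltW.
have : Lam (fun=> 1) = 0.
  apply: (@Lam_lim (fun n => test 0 0 0 (r ^+ n * U0)) _ 1 (fun n => r ^+ n)).
  - by move=> n; apply: test_bounded => //; rewrite !mulr0 ?mul0r mulr_ge0// ltW.
  - by apply: cvg_expr; rewrite ger0_norm// ltW.
  - move=> z zs; exists (3 * U0 * normc z) => n.
    rewrite /test expr0 mul1r normcB.
    have Rz : 0 <= Re ((r ^+ n * U0)%:C * z) by rewrite cReRM mulr_ge0// sector_Re.
    apply: (le_trans (normc_1Bcexp_le Rz)); rewrite normcM normc_real ger0_norm//.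
    by rewrite le_eqVlt; apply/orP; left; apply/eqP; ring.
  - by move=> n; exact: (Hn n).
move/eqP; rewrite subr_eq0 => /eqP.
by congr (_ = _); apply: eq_cintegral => t _; rewrite mulr1.
Qed.

End Continuation.

(** * Integrals of products over product sets *)

Section TensorProduct.
Context {R : realType} {d1 d2 : measure_display}.
Context {T1 : measurableType d1} {T2 : measurableType d2}.
Variables (m1 : {sigma_finite_measure set T1 -> \bar R}).
Variables (m2 : {sigma_finite_measure set T2 -> \bar R}).
Variables (D1 : set T1) (D2 : set T2).
Hypotheses (mD1 : measurable D1) (mD2 : measurable D2).
Local Notation m12 := (m1 \x m2)%E.

Lemma measurable_fst_setX (F : T1 -> R) :
  measurable_fun D1 F -> measurable_fun (D1 `*` D2) (fun t => F t.1).
Proof.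
move=> mF; apply: (@measurable_comp _ _ _ _ _ _ D1 F _ fst) => //.
- by move=> _ [t [? ?] <-].
- exact: measurable_funTS measurable_fst.
Qed.

Lemma measurable_snd_setX (G : T2 -> R) :
  measurable_fun D2 G -> measurable_fun (D1 `*` D2) (fun t => G t.2).
Proof.
move=> mG; apply: (@measurable_comp _ _ _ _ _ _ D2 G _ snd) => //.
- by move=> _ [t [? ?] <-].
- exact: measurable_funTS measurable_snd.
Qed.

(** Fubini's theorem is applied to the extensions by zero. *)
Lemma Rintegral_tensor (F : T1 -> R) (G : T2 -> R) :
  m1.-integrable D1 (EFin \o F) -> m2.-integrable D2 (EFin \o G) ->
  m12.-integrable (D1 `*` D2) (EFin \o (fun t => F t.1 * G t.2)) /\
  Rintegral m12 (D1 `*` D2) (fun t => F t.1 * G t.2) =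
    Rintegral m1 D1 F * Rintegral m2 D2 G.
Proof.
move=> iF iG; pose F' := F \_ D1; pose G' := G \_ D2.
have iF' : m1.-integrable setT (EFin \o F').
  by rewrite /F' -restrict_EFin; apply/integrable_restrict => //; rewrite setTI.
have iG' : m2.-integrable setT (EFin \o G').
  by rewrite /G' -restrict_EFin; apply/integrable_restrict => //; rewrite setTI.
have mF' : measurable_fun setT F' by case/integrableP : iF' => /measurable_EFinP.
have mG' : measurable_fun setT G' by case/integrableP : iG' => /measurable_EFinP.
pose h (t : T1 * T2) := F' t.1 * G' t.2.
have mh : measurable_fun setT (EFin \o h).
  apply/measurable_EFinP; apply: measurable_funM.
    by apply: (measurableT_comp mF'); exact: measurable_fst.
  by apply: (measurableT_comp mG'); exact: measurable_snd.
have hE : (fun t => F t.1 * G t.2) \_ (D1 `*` D2) = h.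
  apply/funext => -[x y]; rewrite /h /F' /G' !patchE /=.
  by rewrite in_setX /=; case: (x \in D1); case: (y \in D2); rewrite /= ?(mul0r, mulr0).
have nF : m1.-integrable setT (EFin \o (fun x => `|F' x|)) by exact: integrable_norm.
have nG : m2.-integrable setT (EFin \o (fun y => `|G' y|)) by exact: integrable_norm.
have ih : m12.-integrable setT (EFin \o h).
  apply/integrable12ltyP => //.
  under eq_integral => x _.
    under eq_integral => y _ do rewrite /= /h /= normrM EFinM.
    rewrite ge0_integralZl//; last by case/integrableP : nG.
    over.
  have fG : (\int[m2]_y (`|G' y|)%:E)%E \is a fin_num by exact: integrable_fin_num nG.
  rewrite -(fineK fG) ge0_integralZr//; last 2 first.
    by case/integrableP : nF.
    by rewrite lee_fin fine_ge0// integral_ge0.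
  have fF : (\int[m1]_y (`|F' y|)%:E)%E \is a fin_num by exact: integrable_fin_num nF.
  by rewrite -(fineK fF) -EFinM ltry.
have ih' : m12.-integrable (D1 `*` D2) (EFin \o (fun t => F t.1 * G t.2)).
  have mQ : measurable (D1 `*` D2) by exact: measurableX.
  have := ih; rewrite -hE -restrict_EFin => /integrable_restrict.
  by rewrite setTI; apply.
split => //.
rewrite Rintegral_mkcond hE [in RHS]Rintegral_mkcond -/F'.
rewrite [X in _ = _ * X]Rintegral_mkcond -/G'.
have fF : (\int[m1]_y (F' y)%:E)%E \is a fin_num by exact: integrable_fin_num iF'.
have fG : (\int[m2]_y (G' y)%:E)%E \is a fin_num by exact: integrable_fin_num iG'.
rewrite /Rintegral -fineM//; congr fine.
rewrite -(integral12_prod_meas1 ih).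
transitivity (\int[m1]_x ((F' x)%:E * \int[m2]_y (G' y)%:E))%E.
  apply: eq_integral => x _; rewrite /fubini_F -(integralZl measurableT iG' (F' x)).
  by apply: eq_integral => y _; rewrite -EFinM.
by rewrite -[in LHS](fineK fG) integralZr// fineK.
Qed.

Lemma cmeasurable_tensor (f : T1 -> R[i]) (g : T2 -> R[i]) :
  cmeasurable D1 f -> cmeasurable D2 g ->
  cmeasurable (D1 `*` D2) (fun t => f t.1 * g t.2).
Proof.
move=> [f1 f2] [g1 g2]; apply: cmeasurableM; split.
- exact: (measurable_fst_setX f1).
- exact: (measurable_fst_setX f2).
- exact: (measurable_snd_setX g1).
- exact: (measurable_snd_setX g2).
Qed.

Lemma cintegral_tensor (f : T1 -> R[i]) (g : T2 -> R[i]) :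
  cintegrable m1 D1 f -> cintegrable m2 D2 g ->
  cintegral m12 (D1 `*` D2) (fun t => f t.1 * g t.2) =
    cintegral m1 D1 f * cintegral m2 D2 g.
Proof.
move=> [f1 f2] [g1 g2].
have mQ : measurable (D1 `*` D2) by exact: measurableX.
have [i11 e11] := Rintegral_tensor f1 g1; have [i12 e12] := Rintegral_tensor f1 g2.
have [i21 e21] := Rintegral_tensor f2 g1; have [i22 e22] := Rintegral_tensor f2 g2.
apply: eqcP; rewrite cReImE /=.
- rewrite -e11 -e22 -RintegralB//.
  by apply: eq_Rintegral => t _; rewrite cReM.
- rewrite -e12 -e21 -RintegralD//.
  by apply: eq_Rintegral => t _; rewrite cImM.
Qed.

End TensorProduct.

(** * The double series and its Laplace transform *)

Section PowerRules.
Context {R : realType}.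
Implicit Types (w p : R[i]) (s t mu : R).

Lemma cpowD p w w' : cpow p (w + w') = cpow p w * cpow p w'.
Proof. by rewrite /cpow mulrDl cexpD. Qed.

Lemma cpow_neq0 p w : cpow p w != 0. Proof. exact: cexp_neq0. Qed.

Lemma cpowXn p w (n : nat) : cpow p (w * n%:R) = cpow p w ^+ n.
Proof. by rewrite /cpow mulrAC mulrC cexpMn mulrC. Qed.

Lemma cpow_1 w : cpow (1 : R[i]) w = 1.
Proof. by rewrite (@cpow_real R 1 w ltr01) ln1 mulr0 cexp0. Qed.

Lemma powR_cpow t mu : 0 < t -> (t `^ mu)%:C = cpow t%:C mu%:C.
Proof.
by move=> t0; rewrite cpow_real// -rmorphM cexp_real /= /powR gt_eqF.
Qed.

Lemma normc_cpow p mu : normc (cpow p mu%:C) = expR (mu * ln (normc p)).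
Proof. by rewrite /cpow normc_cexp cReRM. Qed.

(** Positive dilations do not change the argument, so the principal branch is
multiplicative here. *)
Lemma cpow_dilate s p w : 0 < s -> p != 0 ->
  cpow (s%:C * p) w = cpow s%:C w * cpow p w.
Proof.
move=> s0 pn0; have p0 : 0 < normc p by rewrite normc_gt0.
rewrite cpow_real// /cpow -cexpD -mulrDr; congr (cexp (w * _)).
have nE : normc (s%:C * p) = s * normc p by rewrite normcM normc_real gtr0_norm.
apply: eqcP; rewrite ?cReD ?cImD /=; first by rewrite nE lnM.
rewrite add0r /carg nE cReRM cImRM pmulr_rge0//.
by rewrite -mulf_div divff ?gt_eqF// mul1r.
Qed.

Lemma Re_shift w mu (m : nat) : Re (w + (mu * m%:R)%:C) = Re w + mu * m%:R.
Proof. by rewrite cReD. Qed.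

Lemma Re_shift_gt0 w mu (m : nat) : 0 < Re w -> 0 < mu -> 0 < Re (w + (mu * m%:R)%:C).
Proof.
by move=> w0 mu0; rewrite Re_shift ltr_wpDr// mulr_ge0// ltW.
Qed.

Lemma powexp_shift w p mu t (m : nat) : 0 < t ->
  powexp (w + (mu * m%:R)%:C) p t = powexp w p t * (t `^ mu)%:C ^+ m.
Proof.
move=> t0; rewrite powR_cpow// -cpowXn cpow_real// !powexpE// -cexpD; congr cexp.
by rewrite rmorphM /= (rmorph_nat (real_complex R)); ring.
Qed.

Lemma cpow_shift p w mu (m : nat) :
  cpow p (w + (mu * m%:R)%:C) = cpow p w * cpow p mu%:C ^+ m.
Proof.
by rewrite cpowD -cpowXn rmorphM /= (rmorph_nat (real_complex R)).
Qed.

(** In the right half-plane the exceptional case of [poch] does not occur. *)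
Lemma poch_gt0 w mu (m : nat) : 0 < Re w ->
  poch w (mu * m%:R) = Gamma (w + (mu * m%:R)%:C) / Gamma w.
Proof.
move=> w0; rewrite /poch; case: ifP => // /and3P[_ /natrP[n hn] _].
by have : 0 <= - Re w; [rewrite hn|rewrite oppr_ge0 leNgt w0].
Qed.

End PowerRules.

Section LaplaceTermwise.
Context {R : realType}.
Local Notation leb := (@lebesgue_measure R).
Local Notation D := (`]0, +oo[%classic : set (measurableTypeR R)).
Local Notation leb2 := (leb \x leb)%E.
Variables (c : nat -> nat -> R[i]) (rho1 rho2 p q : R[i]) (mu1 mu2 : R).
Hypotheses (rho1_gt0 : 0 < Re rho1) (rho2_gt0 : 0 < Re rho2).
Hypotheses (mu1_gt0 : 0 < mu1) (mu2_gt0 : 0 < mu2).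
Hypotheses (p_gt0 : 0 < Re p) (q_gt0 : 0 < Re q).

(** The second hypothesis says that the integrals of the moduli of the terms are
summable; the first makes the series meaningful at every point. *)
Lemma laplace2_termwise :
  (forall t1 t2 : R, 0 < t1 -> 0 < t2 ->
    abs_cvg2 (fun m n => c m n * (t1 `^ mu1)%:C ^+ m * (t2 `^ mu2)%:C ^+ n)) ->
  abs_cvg2 (fun m n => c m n *
    (Rintegral leb D (gdens (Re rho1 + mu1 * m%:R) (Re p)) *
     Rintegral leb D (gdens (Re rho2 + mu2 * n%:R) (Re q)))%:C) ->
  let F := fun t1 t2 : R => cpow t1%:C (rho1 - 1) * cpow t2%:C (rho2 - 1) *
    cseries2 (fun m n => c m n * (t1 `^ mu1)%:C ^+ m * (t2 `^ mu2)%:C ^+ n) in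
  laplace2_exists F p q /\
  laplace2 F p q = cseries2 (fun m n => c m n *
    (laplace_pow (rho1 + (mu1 * m%:R)%:C) p * laplace_pow (rho2 + (mu2 * n%:R)%:C) q)).
Proof.
move=> ptw abs F.
have mD := @measurable_halfline R.
have mQ : measurable (D `*` D) by exact: measurableX.
pose f_ m n (t : measurableTypeR R * measurableTypeR R) : R[i] := c m n *
  (powexp (rho1 + (mu1 * m%:R)%:C) p t.1 * powexp (rho2 + (mu2 * n%:R)%:C) q t.2).
have w1 m := Re_shift_gt0 m rho1_gt0 mu1_gt0.
have w2 n := Re_shift_gt0 n rho2_gt0 mu2_gt0.
have mf m n : cmeasurable (D `*` D) (f_ m n).
  apply: cmeasurableM; first exact: cmeasurable_cst.
  by apply: cmeasurable_tensor => //; exact: cmeasurable_powexp.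
have fE m n t : (D `*` D) t -> f_ m n t =
    powexp rho1 p t.1 * powexp rho2 q t.2 *
    (c m n * (t.1 `^ mu1)%:C ^+ m * (t.2 `^ mu2)%:C ^+ n).
  move=> [/in_halfline t1 /in_halfline t2].
  by rewrite /f_ !powexp_shift//; ring.
have absf t : (D `*` D) t -> abs_cvg2 (fun m n => f_ m n t).
  move=> Dt; have [/in_halfline t1 /in_halfline t2] := Dt.
  apply: (@le_abs_cvg2 _ _ _ (normc (powexp rho1 p t.1 * powexp rho2 q t.2)) _ _ (ptw _ _ t1 t2)).
    exact: normc_ge0.
  by move=> m n; rewrite fE// normcM.
have nf m n : (\int[leb2]_(t in D `*` D) (normc (f_ m n t))%:E =
   (normc (c m n * (Rintegral leb D (gdens (Re rho1 + mu1 * m%:R) (Re p)) *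
     Rintegral leb D (gdens (Re rho2 + mu2 * n%:R) (Re q)))%:C))%:E)%E.
  rewrite -!Re_shift.
  have i1 := integrable_gdens (w1 m) p_gt0; have i2 := integrable_gdens (w2 n) q_gt0.
  have [i12 e12] := Rintegral_tensor mD mD i1 i2.
  have r0 s a : 0 <= Rintegral leb D (gdens s a).
    by apply: Rintegral_ge0 => t _; rewrite ltW// gdens_gt0.
  rewrite normcM normc_real ger0_norm ?mulr_ge0//.
  rewrite -e12 EFinM /Rintegral fineK; last exact: integrable_fin_num.
  rewrite -(integralZl mQ i12 (normc (c m n))).
  apply: eq_integral => t /set_mem [/in_halfline t1 /in_halfline t2].
  by rewrite /f_ normcM [normc (powexp _ _ _ * _)]normcM !normc_powexp//= -EFinM.
have [] := cintegral_cseries2 (mu := leb2) mQ mf absf.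
  move/abs_cvg2E : abs; congr (_ < _)%E.
  by apply: eq_eseriesr => m _; apply: eq_eseriesr => n _; rewrite nf.
have E : {in D `*` D, (fun t => cseries2 (fun m n => f_ m n t)) =1
    laplace2_integrand F p q}.
  move=> t /set_mem Dt; have [/in_halfline t1 /in_halfline t2] := Dt.
  rewrite (eq_cseries2 (fun m n => fE m n t Dt)) cseries2Z; last exact: ptw.
  rewrite /laplace2_integrand /F /powexp cexpD; ring.
move=> iF eF; split.
  exact: (eq_cintegrable mQ E iF).
rewrite /laplace2 -[LHS](eq_cintegral leb2 E) eF.
apply: eq_cseries2 => m n.
have i1 := cintegrable_powexp (w1 m) p_gt0; have i2 := cintegrable_powexp (w2 n) q_gt0.
rewrite /f_ cintegralZ//; last first.
  apply: cintegrable_lty => //; first by apply: cmeasurable_tensor => //; exact: cmeasurable_powexp.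
  have j1 := integrable_normc mD i1; have j2 := integrable_normc mD i2.
  have [j12 _] := Rintegral_tensor mD mD j1 j2.
  have [_ h] := integrableP _ _ _ j12.
  apply: le_lt_trans h; rewrite le_eqVlt; apply/orP; left; apply/eqP.
  by apply: eq_integral => t _; rewrite normcM /= ger0_norm// mulr_ge0// normc_ge0.
by rewrite cintegral_tensor.
Qed.

End LaplaceTermwise.

Section LaplaceE8.
Context {R : realType}.
Local Notation leb := (@lebesgue_measure R).
Local Notation D := (`]0, +oo[%classic : set (measurableTypeR R)).
Variables (gamma1 delta1 delta2 delta3 rho1 rho2 : R[i]).
Variables (alpha1 alpha2 alpha3 beta1 beta2 beta3 mu1 mu2 : R).
Hypotheses (rho1_gt0 : 0 < Re rho1) (rho2_gt0 : 0 < Re rho2).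
Hypotheses (mu1_gt0 : 0 < mu1) (mu2_gt0 : 0 < mu2).
Implicit Types (x y p q : R[i]).

Local Notation e8_term :=
  (E8_term gamma1 alpha1 beta1 delta1 alpha2 beta2 delta2 alpha3 delta3 beta3).
Local Notation e8 :=
  (E8 gamma1 alpha1 beta1 delta1 alpha2 beta2 delta2 alpha3 delta3 beta3).
Local Notation e8_abs :=
  (E8_abs_cvg gamma1 alpha1 beta1 delta1 alpha2 beta2 delta2 alpha3 delta3 beta3).
Local Notation d1_term :=
  (D1_term gamma1 alpha1 beta1 rho1 mu1 rho2 mu2
     delta1 alpha2 beta2 delta2 alpha3 delta3 beta3).
Local Notation d1 :=
  (D1 gamma1 alpha1 beta1 rho1 mu1 rho2 mu2
     delta1 alpha2 beta2 delta2 alpha3 delta3 beta3).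
Local Notation d1_abs :=
  (D1_abs_cvg gamma1 alpha1 beta1 rho1 mu1 rho2 mu2
     delta1 alpha2 beta2 delta2 alpha3 delta3 beta3).

Definition e8_original x y (t1 t2 : R) : R[i] :=
  cpow t1%:C (rho1 - 1) * cpow t2%:C (rho2 - 1) *
  e8 (x * (t1 `^ mu1)%:C) (y * (t2 `^ mu2)%:C).

Lemma E8_term_scale x y (a b : R[i]) m n :
  e8_term (x * a) (y * b) m n = e8_term x y m n * a ^+ m * b ^+ n.
Proof. by rewrite /E8_term !exprMn; ring. Qed.

Lemma D1_termE x y (a b : R[i]) m n :
  d1_term (x / a) (y / b) m n = e8_term x y m n *
    (Gamma (rho1 + (mu1 * m%:R)%:C) * Gamma (rho2 + (mu2 * n%:R)%:C)) /
    (Gamma rho1 * Gamma rho2 * (a ^+ m * b ^+ n)).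
Proof.
have E (a0 b0 a1 a2 v1 v2 d2' d3' X Y : R[i]) :
    a0 * (a1 / v1) * (a2 / v2) / b0 * (X / a ^+ m / d2') * (Y / b ^+ n / d3') =
    a0 / b0 * (X / d2') * (Y / d3') * (a1 * a2) / (v1 * v2 * (a ^+ m * b ^+ n)).
  by rewrite !invfM; ring.
by rewrite /D1_term /E8_term !poch_gt0// !expr_div_n E.
Qed.

Lemma normc_E8_term x y m n :
  normc (e8_term x y m n) = normc (e8_term 1 1 m n) * normc x ^+ m * normc y ^+ n.
Proof.
by rewrite -{1}(mul1r x) -{1}(mul1r y) E8_term_scale !normcM !normcX.
Qed.

Lemma normc_D1_term x y m n :
  normc (d1_term x y m n) = normc (d1_term 1 1 m n) * normc x ^+ m * normc y ^+ n.
Proof.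
have -> : d1_term x y m n = d1_term 1 1 m n * x ^+ m * y ^+ n.
  by rewrite /D1_term !expr1n; ring.
by rewrite !normcM !normcX.
Qed.

Lemma E8_abs_mono x y x' y' : normc x' <= normc x -> normc y' <= normc y ->
  e8_abs x y -> e8_abs x' y'.
Proof.
move=> hx hy; apply: (@le_abs_cvg2 _ _ _ 1) => // m n.
rewrite mul1r (normc_E8_term x' y') (normc_E8_term x y).
by rewrite !ler_pM ?mulr_ge0 ?exprn_ge0 ?normc_ge0// lerXn2r ?nnegrE ?normc_ge0.
Qed.

Lemma D1_abs_mono x y x' y' : normc x' <= normc x -> normc y' <= normc y ->
  d1_abs x y -> d1_abs x' y'.
Proof.
move=> hx hy; apply: (@le_abs_cvg2 _ _ _ 1) => // m n.
rewrite mul1r (normc_D1_term x' y') (normc_D1_term x y).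
by rewrite !ler_pM ?mulr_ge0 ?exprn_ge0 ?normc_ge0// lerXn2r ?nnegrE ?normc_ge0.
Qed.

(** The modulus of [p ^ mu] is [|p| ^ mu], because [mu] is real. *)
Lemma normc_div_cpow_le x p (mu : R) : 0 < mu -> 0 < Re p ->
  normc (x / cpow p mu%:C) <= normc (x / ((Re p) `^ mu)%:C).
Proof.
move=> mu0 p0; have np0 : 0 < normc p by rewrite normc_gt0 Re_gt0_neq0.
rewrite !normcM !normcV ler_wpM2l ?normc_ge0// powR_cpow// !normc_cpow.
rewrite lef_pV2 ?posrE ?expR_gt0// ler_expR ler_wpM2l ?(ltW mu0)//.
rewrite normc_real gtr0_norm// ler_ln ?posrE//.
by apply: le_trans (ler_norm _) (Re_le_normc p).
Qed.

(** Absolute convergence of the transformed series at the real parts of [p]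
and [q] is what Tonelli's theorem requires. *)
Lemma laplace2_E8 x y p q : 0 < Re p -> 0 < Re q ->
  (forall t1 t2 : R, 0 < t1 -> 0 < t2 ->
    e8_abs (x * (t1 `^ mu1)%:C) (y * (t2 `^ mu2)%:C)) ->
  d1_abs (x / ((Re p) `^ mu1)%:C) (y / ((Re q) `^ mu2)%:C) ->
  laplace2_exists (e8_original x y) p q /\
  laplace2 (e8_original x y) p q =
    Gamma rho1 * Gamma rho2 / (cpow p rho1 * cpow q rho2) *
    d1 (x / cpow p mu1%:C) (y / cpow q mu2%:C).
Proof.
move=> p0 q0 he hd.
have G1 := Gamma_neq0 rho1_gt0; have G2 := Gamma_neq0 rho2_gt0.
have w1 m := Re_shift_gt0 m rho1_gt0 mu1_gt0.
have w2 n := Re_shift_gt0 n rho2_gt0 mu2_gt0.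
have ptw (t1 t2 : R) : 0 < t1 -> 0 < t2 ->
    abs_cvg2 (fun m n => e8_term x y m n * (t1 `^ mu1)%:C ^+ m * (t2 `^ mu2)%:C ^+ n).
  move=> t10 t20; apply: (@le_abs_cvg2 _ _ _ 1 _ _ (he t1 t2 t10 t20)) => // m n.
  by rewrite E8_term_scale mul1r.
have [C1 C10 H1] := rgamma_le_Gamma rho1_gt0 mu1_gt0.
have [C2 C20 H2] := rgamma_le_Gamma rho2_gt0 mu2_gt0.
have gI (rho p' : R[i]) (mu : R) m : 0 < Re rho -> 0 < Re p' -> 0 < mu ->
    Rintegral leb D (gdens (Re rho + mu * m%:R) (Re p')) =
    rgamma (Re rho + mu * m%:R) * expR (- (Re rho * ln (Re p'))) * ((Re p') `^ mu) ^- m.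
  move=> r0 p'0 mu0; rewrite Rintegral_gdens//; last first.
    by rewrite -Re_shift Re_shift_gt0.
  rewrite -mulrA; congr (_ * _).
  rewrite /powR gt_eqF// -expRM_natl -expRN -expRD; congr expR; ring.
have abs : abs_cvg2 (fun m n => e8_term x y m n *
    (Rintegral leb D (gdens (Re rho1 + mu1 * m%:R) (Re p)) *
     Rintegral leb D (gdens (Re rho2 + mu2 * n%:R) (Re q)))%:C).
  pose k1 := expR (- (Re rho1 * ln (Re p))); pose k2 := expR (- (Re rho2 * ln (Re q))).
  have k10 : 0 <= k1 := expR_ge0 _; have k20 : 0 <= k2 := expR_ge0 _.
  apply: (@le_abs_cvg2 _ _ _
    (C1 * k1 * (C2 * k2) * (normc (Gamma rho1) * normc (Gamma rho2))) _ _ hd).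
    by rewrite !mulr_ge0 ?normc_ge0.
  move=> m n; rewrite !gI// -/k1 -/k2 D1_termE.
  set a := (Re p) `^ mu1; set b := (Re q) `^ mu2.
  have a0 : 0 < a by rewrite powR_gt0.
  have b0 : 0 < b by rewrite powR_gt0.
  set g1 := Gamma (rho1 + _); set g2 := Gamma (rho2 + _).
  have rg1 : 0 <= rgamma (Re rho1 + mu1 * m%:R).
    by rewrite -Re_shift ltW// rgamma_gt0.
  have rg2 : 0 <= rgamma (Re rho2 + mu2 * n%:R).
    by rewrite -Re_shift ltW// rgamma_gt0.
  have am0 : 0 <= a ^- m by rewrite invr_ge0 exprn_ge0// ltW.
  have bn0 : 0 <= b ^- n by rewrite invr_ge0 exprn_ge0// ltW.
  have h1 : rgamma (Re rho1 + mu1 * m%:R) * k1 * a ^- m <= C1 * normc g1 * k1 * a ^- m.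
    by rewrite !ler_wpM2r.
  have h2 : rgamma (Re rho2 + mu2 * n%:R) * k2 * b ^- n <= C2 * normc g2 * k2 * b ^- n.
    by rewrite !ler_wpM2r.
  have h3 := ler_pM (mulr_ge0 (mulr_ge0 rg1 k10) am0) (mulr_ge0 (mulr_ge0 rg2 k20) bn0) h1 h2.
  rewrite normcM normc_real ger0_norm; last by rewrite !mulr_ge0.
  apply: (le_trans (ler_wpM2l (normc_ge0 (e8_term x y m n)) h3)).
  have nE (e u1 u2 v1 v2 : R[i]) :
      normc (e * (u1 * u2) / (v1 * v2 * (a%:C ^+ m * b%:C ^+ n))) =
      normc e * (normc u1 * normc u2) / (normc v1 * normc v2 * (a ^+ m * b ^+ n)).
    by rewrite !(normcM, normcV, normcX) !normc_real !gtr0_norm.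
  (* Gamma values are abstracted away: Gamma is defined as a quotient, which the
     arithmetic tactics would otherwise unfold *)
  rewrite nE; have N1 : normc (Gamma rho1) != 0 by rewrite gt_eqF// normc_gt0.
  have N2 : normc (Gamma rho2) != 0 by rewrite gt_eqF// normc_gt0.
  have A0 : a ^+ m != 0 by rewrite expf_neq0// gt_eqF.
  have B0 : b ^+ n != 0 by rewrite expf_neq0// gt_eqF.
  rewrite le_eqVlt; apply/orP; left; apply/eqP.
  move: (normc (Gamma rho1)) (normc (Gamma rho2)) (normc g1) (normc g2)
    (normc (e8_term x y m n)) (a ^+ m) (b ^+ n) N1 N2 A0 B0.
  by move=> v1 v2 u1 u2 e A B v10 v20 A0 B0; field; rewrite v10 v20 A0 B0.
have [ex eq] := laplace2_termwise rho1_gt0 rho2_gt0 mu1_gt0 mu2_gt0 p0 q0 ptw abs.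
have FE : (fun t1 t2 : R => cpow t1%:C (rho1 - 1) * cpow t2%:C (rho2 - 1) *
    cseries2 (fun m n => e8_term x y m n * (t1 `^ mu1)%:C ^+ m * (t2 `^ mu2)%:C ^+ n))
    = e8_original x y.
  apply/funext => t1; apply/funext => t2; rewrite /e8_original /E8.
  by congr (_ * _); apply: eq_cseries2 => m n; rewrite E8_term_scale.
move: ex eq; rewrite FE => ex ->; split=> //.
rewrite /D1 -cseries2Z; last first.
  by apply: D1_abs_mono hd; apply: normc_div_cpow_le.
apply: eq_cseries2 => m n; rewrite !laplace_powE// !cpow_shift D1_termE.
move: (cpow_neq0 p rho1) (cpow_neq0 q rho2).
have := expf_neq0 m (cpow_neq0 p mu1%:C); have := expf_neq0 n (cpow_neq0 q mu2%:C).
move: (cpow p rho1) (cpow q rho2) (_ ^+ m) (_ ^+ n) (Gamma rho1) (Gamma rho2) G1 G2.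
move=> P Q A B v1 v2 v10 v20 B0 A0 P0 Q0.
by field; rewrite v10 v20 A0 B0 P0 Q0.
Qed.

End LaplaceE8.

(** * Continuation from large rates to the given parameters *)

Section Sectors.
Context {R : realType}.
Implicit Types (p q : R[i]) (t : R * R).

(** The exponent of the Laplace kernel; scaling [(p, q)] scales it. *)
Definition laplace_phase p q t : R[i] := t.1%:C * p + t.2%:C * q.

Lemma laplace_phase_sector p q : 0 < Re p -> 0 < Re q ->
  exists c : R, [/\ 0 < c, c <= 1 &
    forall t, quadrant t ->
      c * normc (laplace_phase p q t) <= Re (laplace_phase p q t)].
Proof.
move=> p0 q0.
have np : 0 < normc p by rewrite normc_gt0 Re_gt0_neq0.
have nq : 0 < normc q by rewrite normc_gt0 Re_gt0_neq0.
pose c := Num.min (Re p / normc p) (Re q / normc q).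
have cp : c * normc p <= Re p by rewrite -ler_pdivlMr// ge_min lexx.
have cq : c * normc q <= Re q by rewrite -ler_pdivlMr// ge_min lexx orbT.
have c0 : 0 < c by rewrite lt_min !divr_gt0.
exists c; split=> //.
  rewrite ge_min ler_pdivrMr// mul1r.
  by rewrite (le_trans (ler_norm _) (Re_le_normc p)).
move=> [t1 t2] [/in_halfline/= t10 /in_halfline/= t20].
rewrite /laplace_phase cReD !cReRM /=.
apply: (le_trans (ler_wpM2l (ltW c0) (ler_normcD _ _))).
rewrite !normcM !normc_real !gtr0_norm//.
have := ler_wpM2l (ltW t10) cp; have := ler_wpM2l (ltW t20) cq.
by lra.
Qed.

Lemma cmeasurable_laplace_phase p q :
  cmeasurable (quadrant : set (measurableTypeR R * measurableTypeR R)) (laplace_phase p q).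
Proof.
apply: cmeasurableD; apply: cmeasurableM; try exact: cmeasurable_cst.
- by apply: cmeasurable_real; apply: measurable_funTS; exact: measurable_fst.
- by apply: cmeasurable_real; apply: measurable_funTS; exact: measurable_snd.
Qed.

Lemma laplace2_integrand_shift (f : R -> R -> R[i]) p q (u : R) t :
  laplace2_integrand f p q t * cexp (- (u%:C * laplace_phase p q t)) =
  laplace2_integrand f ((1 + u)%:C * p) ((1 + u)%:C * q) t.
Proof.
rewrite /laplace2_integrand -mulrA -cexpD; congr (_ * cexp _).
by rewrite /laplace_phase rmorphD /=; ring.
Qed.

End Sectors.

Unset Implicit Arguments.

Theorem mainTheorem14 (R : realType)
  (gamma1 delta1 delta2 delta3 x y rho1 rho2 p q : R[i])
  (alpha1 alpha2 alpha3 beta1 beta2 beta3 mu1 mu2 : R)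
  (rho1_gt0 : 0 < complex.Re rho1) (rho2_gt0 : 0 < complex.Re rho2)
  (alpha1_gt0 : 0 < alpha1) (alpha2_gt0 : 0 < alpha2) (alpha3_gt0 : 0 < alpha3)
  (beta1_gt0 : 0 < beta1) (beta2_gt0 : 0 < beta2) (beta3_gt0 : 0 < beta3)
  (mu1_gt0 : 0 < mu1) (mu2_gt0 : 0 < mu2)
  (p_gt0 : 0 < complex.Re p) (q_gt0 : 0 < complex.Re q)
  (E8_cvg : forall t1 t2 : R, 0 < t1 -> 0 < t2 ->
    E8_abs_cvg gamma1 alpha1 beta1
      delta1 alpha2 beta2 delta2 alpha3 delta3 beta3
      (x * (powR t1 mu1)%:C) (y * (powR t2 mu2)%:C))
  (D1_cvg : D1_abs_cvg gamma1 alpha1 beta1 rho1 mu1 rho2 mu2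
      delta1 alpha2 beta2 delta2 alpha3 delta3 beta3
      (x / cpow p mu1%:C) (y / cpow q mu2%:C)) :
  let F := fun t1 t2 : R =>
    cpow t1%:C (rho1 - 1) * cpow t2%:C (rho2 - 1) *
    E8 gamma1 alpha1 beta1 delta1 alpha2 beta2 delta2 alpha3 delta3 beta3
      (x * (powR t1 mu1)%:C) (y * (powR t2 mu2)%:C) in
  (D1_abs_cvg gamma1 alpha1 beta1 rho1 mu1 rho2 mu2
      delta1 alpha2 beta2 delta2 alpha3 delta3 beta3
      (x / (powR (complex.Re p) mu1)%:C) (y / (powR (complex.Re q) mu2)%:C) ->
    laplace2_exists F p q) /\
  (laplace2_exists F p q ->
    laplace2 F p q =
    Gamma rho1 * Gamma rho2 / (cpow p rho1 * cpow q rho2) *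
    D1 gamma1 alpha1 beta1 rho1 mu1 rho2 mu2
      delta1 alpha2 beta2 delta2 alpha3 delta3 beta3
      (x / cpow p mu1%:C) (y / cpow q mu2%:C)).
Proof.
move=> F; split=> [dabs|iF].
  by have [] := laplace2_E8 rho1_gt0 rho2_gt0 mu1_gt0 mu2_gt0 p_gt0 q_gt0 E8_cvg dabs.
have pn0 := Re_gt0_neq0 p_gt0; have qn0 := Re_gt0_neq0 q_gt0.
have np : 0 < normc p by rewrite normc_gt0.
have nq : 0 < normc q by rewrite normc_gt0.
set x1 := x / cpow p mu1%:C; set y1 := y / cpow q mu2%:C.
have scale1 (z p' : R[i]) (mu t : R) : 0 < mu -> 0 < normc p' -> 0 < t ->
    normc (z / cpow p' mu%:C * (powR t mu)%:C) <= normc (z * (powR (t / normc p') mu)%:C).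
  move=> mu0 np' t0; rewrite powR_cpow// powR_cpow ?divr_gt0//.
  rewrite !normcM normcV !normc_cpow !normc_real !gtr0_norm ?divr_gt0//.
  rewrite ln_div ?posrE// mulrBr expRB.
  by rewrite le_eqVlt; apply/orP; left; apply/eqP; ring.
have E8_cvg1 (t1 t2 : R) : 0 < t1 -> 0 < t2 ->
    E8_abs_cvg gamma1 alpha1 beta1 delta1 alpha2 beta2 delta2 alpha3 delta3 beta3
      (x1 * (powR t1 mu1)%:C) (y1 * (powR t2 mu2)%:C).
  move=> t10 t20; apply: (E8_abs_mono (scale1 x p mu1 t1 mu1_gt0 np t10)
    (scale1 y q mu2 t2 mu2_gt0 nq t20)).
  by apply: E8_cvg; rewrite divr_gt0.
(* the original function for the data [x1, y1]; its transform at [(s, s)] is known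
   for all [s >= 1] *)
pose F1 := e8_original gamma1 delta1 delta2 delta3 rho1 rho2
  alpha1 alpha2 alpha3 beta1 beta2 beta3 mu1 mu2 x1 y1.
have real_case (s : R) : 1 <= s -> laplace2_exists F1 s%:C s%:C /\
  laplace2 F1 s%:C s%:C = Gamma rho1 * Gamma rho2 / (cpow s%:C rho1 * cpow s%:C rho2) *
    D1 gamma1 alpha1 beta1 rho1 mu1 rho2 mu2
      delta1 alpha2 beta2 delta2 alpha3 delta3 beta3
      (x1 / cpow s%:C mu1%:C) (y1 / cpow s%:C mu2%:C).
  move=> s1; have s0 : 0 < s := lt_le_trans ltr01 s1.
  have sR : 0 < Re s%:C := s0.
  apply: (laplace2_E8 rho1_gt0 rho2_gt0 mu1_gt0 mu2_gt0 sR sR E8_cvg1).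
  have h (z : R[i]) (mu : R) : 0 < mu -> normc (z / (powR s mu)%:C) <= normc z.
    move=> mu0; rewrite normcM normcV ler_piMr ?normc_ge0//.
    rewrite powR_cpow// normc_cpow normc_real gtr0_norm// invf_le1 ?expR_gt0//.
    by rewrite -expR0 ler_expR mulr_ge0 ?(ltW mu0)// ln_ge0.
  exact: (D1_abs_mono (h x1 mu1 mu1_gt0) (h y1 mu2 mu2_gt0) D1_cvg).
(* beyond this rate [s Re p >= |p|] and [s Re q >= |q|] *)
pose U := normc p / Re p + normc q / Re q.
have complex_case (s : R) : U <= s -> 0 < s ->
  laplace2_exists F (s%:C * p) (s%:C * q) /\
  laplace2 F (s%:C * p) (s%:C * q) =
  Gamma rho1 * Gamma rho2 / (cpow (s%:C * p) rho1 * cpow (s%:C * q) rho2) *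
    D1 gamma1 alpha1 beta1 rho1 mu1 rho2 mu2
      delta1 alpha2 beta2 delta2 alpha3 delta3 beta3
      (x / cpow (s%:C * p) mu1%:C) (y / cpow (s%:C * q) mu2%:C).
  move=> Us s0.
  have sp0 : 0 < Re (s%:C * p) by rewrite cReRM mulr_gt0.
  have sq0 : 0 < Re (s%:C * q) by rewrite cReRM mulr_gt0.
  have Up : normc p <= s * Re p.
    rewrite -ler_pdivrMr//; apply: le_trans Us.
    by rewrite /U lerDl divr_ge0// ltW.
  have Uq : normc q <= s * Re q.
    rewrite -ler_pdivrMr//; apply: le_trans Us.
    by rewrite /U lerDr divr_ge0// ltW.
  have h (z p' : R[i]) (mu : R) : 0 < mu -> 0 < normc p' -> normc p' <= s * Re p' ->
      normc (z / (powR (Re (s%:C * p')) mu)%:C) <= normc (z / cpow p' mu%:C).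
    move=> mu0 np' le; have r0 : 0 < s * Re p' := lt_le_trans np' le.
    rewrite cReRM !normcM !normcV ler_wpM2l ?normc_ge0//.
    rewrite powR_cpow// !normc_cpow normc_real gtr0_norm//.
    by rewrite lef_pV2 ?posrE ?expR_gt0// ler_expR ler_wpM2l ?(ltW mu0)// ler_ln ?posrE.
  apply: (laplace2_E8 rho1_gt0 rho2_gt0 mu1_gt0 mu2_gt0 sp0 sq0 E8_cvg).
  exact: (D1_abs_mono (h x p mu1 mu1_gt0 np Up) (h y q mu2 mu2_gt0 nq Uq) D1_cvg).
have [i1 e1] := real_case 1 (lexx _).
have [c [c0 c1 sec1]] := laplace_phase_sector p_gt0 q_gt0.
have [c' [c'0 c'1 sec2]] := laplace_phase_sector (@ltr01 R : 0 < Re (1 : R[i])) (@ltr01 R : 0 < Re (1 : R[i])).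
have mQ : measurable (quadrant : set (measurableTypeR R * measurableTypeR R)).
  by apply: measurableX; exact: measurable_itv.
pose cc := Num.min c c'.
have cc0 : 0 < cc by rewrite lt_min c0.
have cc1 : cc <= 1 by rewrite ge_min c1.
pose k := cpow p rho1 * cpow q rho2.
have k0 : k != 0 by rewrite mulf_neq0 ?cpow_neq0.
have main : cintegral (lebesgue_measure \x lebesgue_measure)%E quadrant
     (fun t => k * laplace2_integrand F p q t) =
   cintegral (lebesgue_measure \x lebesgue_measure)%E quadrant
     (laplace2_integrand F1 1 1).
  apply: (@laplace_continuation _ _ _ _ _ mQ _ _
    (laplace_phase p q) (laplace_phase 1 1) cc cc0 cc1 _ _ _ _ _ _ U).
  - exact: cintegrableZ.
  - exact: i1.
  - exact: cmeasurable_laplace_phase.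
  - exact: cmeasurable_laplace_phase.
  - move=> t Qt; apply: le_trans (sec1 t Qt); rewrite ler_wpM2r ?normc_ge0//.
    by rewrite ge_min lexx.
  - move=> t Qt; apply: le_trans (sec2 t Qt); rewrite ler_wpM2r ?normc_ge0//.
    by rewrite ge_min lexx orbT.
  move=> u Uu; have u0 : 0 <= u.
    by apply: le_trans Uu; rewrite addr_ge0// divr_ge0// ltW.
  have s1 : 1 <= 1 + u by rewrite lerDl.
  have s0 : 0 < 1 + u := lt_le_trans ltr01 s1.
  have Us : U <= 1 + u by apply: (le_trans Uu); rewrite lerDr.
  have [jF eF] := complex_case _ Us s0; have [jF1 eF1] := real_case _ s1.
  transitivity (k * laplace2 F ((1 + u)%:C * p) ((1 + u)%:C * q)).
    rewrite -[RHS](cintegralZ mQ k jF); apply: eq_cintegral => t _.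
    by rewrite -mulrA laplace2_integrand_shift.
  transitivity (laplace2 F1 (1 + u)%:C (1 + u)%:C); last first.
    by apply: eq_cintegral => t _; rewrite laplace2_integrand_shift mulr1.
  apply: etrans (congr1 (fun z => k * z) eF) _; apply: etrans _ (esym eF1).
  have xE (z p' : R[i]) (mu : R) : p' != 0 ->
      z / cpow ((1 + u)%:C * p') mu%:C = z / cpow p' mu%:C / cpow (1 + u)%:C mu%:C.
    by move=> p'0; rewrite cpow_dilate// invfM mulrA mulrAC.
  have alg (S g P Q A B P' Q' : R[i]) : P != 0 -> Q != 0 -> A != 0 -> B != 0 ->
      P' = A * P -> Q' = B * Q -> P * Q * (g / (P' * Q') * S) = g / (A * B) * S.
    by move=> P0 Q0 A0 B0 -> ->; field; rewrite P0 Q0 A0 B0.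
  apply: etrans (alg _ _ _ _ _ _ _ _ (cpow_neq0 p rho1) (cpow_neq0 q rho2)
    (cpow_neq0 (1 + u)%:C rho1) (cpow_neq0 (1 + u)%:C rho2)
    (cpow_dilate rho1 s0 pn0) (cpow_dilate rho2 s0 qn0)) _.
  exact: (f_equal2 (fun a b => _ * D1 gamma1 alpha1 beta1 rho1 mu1 rho2 mu2
    delta1 alpha2 beta2 delta2 alpha3 delta3 beta3 a b)
    (xE x p mu1 pn0) (xE y q mu2 qn0)).
have kL : k * laplace2 F p q = cintegral (lebesgue_measure \x lebesgue_measure)%E quadrant
     (fun t => k * laplace2_integrand F p q t).
  by rewrite (cintegralZ mQ k iF).
have {}kL : k * laplace2 F p q = laplace2 F1 1%:C 1%:C by rewrite kL.
have c1E w : cpow (1 : R)%:C w = 1 := cpow_1 w.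
have divc1E (z w : R[i]) : z / cpow (1 : R)%:C w = z by rewrite c1E divr1.
have alg (L g A B S S' : R[i]) : k * L = g / (A * B) * S -> A = 1 -> B = 1 -> S = S' ->
    L = g / k * S'.
  move=> + A1 B1 SS; rewrite A1 B1 SS mulr1 divr1 => kLE.
  by apply: (mulfI k0); rewrite kLE; field.
apply: alg (etrans kL e1) (c1E rho1) (c1E rho2) _.
exact: (f_equal2 (D1 gamma1 alpha1 beta1 rho1 mu1 rho2 mu2
    delta1 alpha2 beta2 delta2 alpha3 delta3 beta3) (divc1E x1 _) (divc1E y1 _)).
Qed.
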